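(* Let $d>1$ be an integer, let $K$ be any field, let $R=K[x_1,x_2,z_1,z_2]$, and let $$J=(x_1z_1^d,\; x_1z_2^d,\; x_2z_1^{d-1}z_2)+(z_1,z_2)^{d+1}\subset R.$$ Then $J^k$ has linear quotients for every positive integer $k<d$, and $J^d$ has a first-syzygy of degree $d$. In particular, $\operatorname{reg}(J^k)=k(d+1)$ for every positive integer $k<d$, and $\operatorname{reg}(J^d)\geq d(d+1)+d-1$; and this holds independently of the field $K$.
   Context: All polynomial rings have the standard grading (every variable has degree $1$). For a homogeneous ideal $I$ of a polynomial ring $R$ over a field $K$, set $\beta_{ij}(I)=\dim_K \operatorname{Tor}^R_i(I,K)_j$ and $t_i(I)=\max\{j : \beta_{ij}(I)\neq 0\}$, with $t_i(I)=-\infty$ if $\operatorname{Tor}^R_i(I,K)=0$. The Castelnuovo-Mumford regularity of $I$ is $\operatorname{reg}(I)=\sup\{t_i(I)-i : i\in\mathbb{N}\}$. An ideal $I$ generated in a single degree has linear quotients if there exists a system of minimal generators $f_1,\dots,f_s$ of $I$ such that for every $k\leq s$ the colon ideal $(f_1,\dots,f_{k-1}):f_k$ is generated by linear forms (the zero ideal being allowed). The ideal $J^d$ is generated in the single degree $d(d+1)$. ''$J^d$ has a first-syzygy of degree $d$'' means that among the minimal first syzygies of $J^d$ (with respect to a minimal system of homogeneous generators) there is one whose nonzero coefficients are homogeneous of degree $d$, that is, $\beta_{1,\,d(d+1)+d}(J^d)\neq 0$. *)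

(* Defs.v *)
From HB Require Import structures.
From mathcomp Require Import all_boot all_order all_algebra.
From mathcomp Require Import mpoly.
From mathcomp Require Import boolp classical_sets constructive_ereal.
From Stdlib Require Import ClassicalEpsilon.

Set Implicit Arguments.
Unset Strict Implicit.
Unset Printing Implicit Defensive.

Import Order.TTheory GRing.Theory Num.Theory.

Local Open Scope classical_set_scope.
Local Open Scope ring_scope.

(* Ideals are represented by their underlying (Prop-valued)
   sets; all the ideals below are built by operations that return ideals. *)

Section Ideals.

Variables (n : nat) (K : fieldType).
Local Notation R := {mpoly K[n]}.
Implicit Types (I : set R) (f : R) (fs : seq R).

Definition idealgen (S : set R) : set R :=
  [set p | exists s : seq (R * R),
     (forall u, u \in s -> S u.2) /\ p = \sum_(u <- s) u.1 * u.2].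

Definition idealadd I I' : set R :=
  [set p | exists a b, [/\ I a, I' b & p = a + b]].

Definition idealmul I I' : set R :=
  idealgen [set p | exists a b, [/\ I a, I' b & p = a * b]].

Fixpoint idealexp I (k : nat) : set R :=
  if k is k'.+1 then idealmul I (idealexp I k') else setT.

Definition idealcolon I f : set R := [set g | I (g * f)].

Definition minimal_generators I fs : Prop :=
  idealgen [set` fs] = I /\
  (forall i, (i < size fs)%N -> idealgen [set` take i fs ++ drop i.+1 fs] <> I).

(* L = set0 gives the zero colon ideal. *)
Definition linear_quotients I : Prop :=
  exists (D : nat) (fs : seq R),
    [/\ forall f, f \in fs -> f \is D.-homog,
        minimal_generators I fs &
        forall k, (k < size fs)%N ->
          exists L : set R,
            (forall l, L l -> l \is 1.-homog) /\
            idealcolon (idealgen [set` take k fs]) fs`_k = idealgen L].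

End Ideals.

(* Data of a complex ... -> F_1 -> F_0 -> R of finitely generated graded free
   modules: F_i = \bigoplus_b R(- gshift i b). Elements are row vectors, and the
   maps act by right multiplication. *)
Record gfree (n : nat) (K : fieldType) := GFree {
  grank : nat -> nat;
  gshift : forall i, 'I_(grank i) -> nat;
  gdiff : forall i, 'M[{mpoly K[n]}]_(grank i.+1, grank i);
  gaug : 'cV[{mpoly K[n]}]_(grank 0)
}.

Section Betti.

Variables (n : nat) (K : fieldType).
Local Notation R := {mpoly K[n]}.

(* F, augmented by gaug, is a graded free resolution of the module I. *)
Definition is_resolution (I : set R) (F : gfree n K) : Prop :=
  [/\ forall i a b,
        if (gshift b <= gshift a)%N
        then gdiff F i a b \is (gshift a - gshift b).-homog
        else gdiff F i a b == 0,
      forall b, gaug F b 0 \is (gshift b).-homog,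
      forall p, I p <-> exists v : 'rV[R]_(grank F 0), v *m gaug F = p%:M,
      forall v : 'rV[R]_(grank F 0),
        v *m gaug F = 0 <-> exists u, v = u *m gdiff F 0 &
      forall i (v : 'rV[R]_(grank F i.+1)),
        v *m gdiff F i = 0 <-> exists u, v = u *m gdiff F i.+1].

(* The differential of F \otimes_R K, where K = R / (X_0, ..., X_(n-1)). *)
Definition kdiff (F : gfree n K) i : 'M[K]_(grank F i.+1, grank F i) :=
  map_mx (mcoeff 0%MM) (gdiff F i).

(* The row space is the degree j component of F_i \otimes_R K. *)
Definition kcomp (F : gfree n K) i j : 'M[K]_(grank F i) :=
  diag_mx (\row_b (gshift b == j)%:R).

Definition kcycles (F : gfree n K) i j : 'M[K]_(grank F i) :=
  match i with
  | 0 => kcomp F 0 j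
  | i'.+1 => (kcomp F i'.+1 j :&: kermx (kdiff F i'))%MS
  end.

Definition kboundaries (F : gfree n K) i j :
  'M[K]_(grank F i.+1, grank F i) := kcomp F i.+1 j *m kdiff F i.

(* dim_K H_i(F \otimes_R K)_j *)
Definition hdim (F : gfree n K) i j : nat :=
  (\rank (kcycles F i j) - \rank (kboundaries F i j))%N.

Definition gfree0 : gfree n K :=
  GFree (fun i (b : 'I_0) => 0%N) (fun i => 0) 0.

(* Any graded free resolution computes Tor; one is chosen here. Homogeneous
   ideals do have resolutions with finite ranks and nonnegative shifts. *)
Definition resolution (I : set R) : gfree n K :=
  epsilon (inhabits gfree0) (is_resolution I).

(* dim_K Tor_i^R(I, K)_j *)
Definition betti (I : set R) (i j : nat) : nat := hdim (resolution I) i j.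

(* Every subset of \bar int has a least upper bound. As only finitely many j
   have betti I i j != 0, this one is a maximum, or -oo if there is no such j. *)
Definition tmax (I : set R) (i : nat) : \bar int :=
  supremum (-oo)%E [set (j%:Z)%:E | j in [set j : nat | betti I i j != 0%N]].

Definition reg (I : set R) : \bar int :=
  supremum (-oo)%E [set (tmax I i - (i%:Z)%:E)%E | i in [set: nat]].

End Betti.

Section TheIdeal.

Variable K : fieldType.

Definition x1 : {mpoly K[4]} := 'X_(@Ordinal 4 0 isT).
Definition x2 : {mpoly K[4]} := 'X_(@Ordinal 4 1 isT).
Definition z1 : {mpoly K[4]} := 'X_(@Ordinal 4 2 isT).
Definition z2 : {mpoly K[4]} := 'X_(@Ordinal 4 3 isT).

Definition idealJ (d : nat) : set {mpoly K[4]} :=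
  idealadd
    (idealgen
       [set` [:: x1 * z1 ^+ d; x1 * z2 ^+ d; x2 * z1 ^+ d.-1 * z2]])
    (idealexp (idealgen [set` [:: z1; z2]]) d.+1).

End TheIdeal.

Arguments idealJ K d : clear implicits.

(* Main.v *)
From HB Require Import structures.
Require Import Defs.
From mathcomp Require Import all_boot all_order all_algebra.
From mathcomp Require Import mpoly.
From mathcomp Require Import boolp classical_sets constructive_ereal.
From mathcomp Require Import zify.

Import Order.TTheory GRing.Theory Num.Theory.
Local Open Scope ring_scope.

(** All the ideals are monomial, so everything reduces to exponents. A monomial
    in [J^k] of degree [a] in [x_1, x_2] is a product of [a] of the three special
    generators and of [k - a] factors from [(z_1, z_2)^(d+1)]. If [a < k], such a
    factor makes the exponents of [z_1] and [z_2] free between two bounds, because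
    [d + 1] exceeds the step [d] between the exponents of [z_2] in [x_1 z_1^d] and
    [x_1 z_2^d]. If [a = k], the exponent of [z_2] is [r + d q], where [r] is the
    exponent of [x_2] (lemma [idealexpJE]).

    Order the generators by [a], and then by the sum of the exponents of [x_2] and
    [z_2]. For
    a generator with [a > 0], replacing one of the [x]'s by [z_1] or by [z_2] gives
    an earlier generator, so the colon ideal contains [z_1] and [z_2]; what is left
    are generators with the same [z]-part, which only differ by an exchange of
    [x_2] for [x_1]. If [a < k] these exchanges can be made one at a time. If
    [a = k < d] there are none, since [r] is the residue modulo [d] of the exponent
    of [z_2] (lemma [Jgen_neighbor]). For [k = d] the values [r = 0] and [r = d]
    meet: with [w = z_1^(d(d-1)) z_2^d], both [x_1^d w] and [x_2^d w] are
    generators, and no other generator of [J^d] divides their least common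
    multiple, of degree [d(d+1) + d]. Their syzygy of degree [d] is therefore
    minimal.

    The Betti numbers are those of an arbitrary resolution, so two facts are needed.
    First, resolutions exist, and they are linear in the presence of linear
    quotients (theorem [mideal_resolution]): as in Schreyer's theorem, if the
    leading ideals of a module of relations are monomial, so are those of the
    syzygies of the corresponding generators, and these leading ideals are colon
    ideals; a colon ideal generated by variables has linear quotients itself.
    Second, a resolution tells when Tor vanishes: it vanishes above the linear
    strand by comparison with a linear resolution (lemma [hdim_linear]), and it does
    not vanish at the syzygy above because a linear form on the free module
    separates this syzygy from the combinations of other ones with coefficients in
    the maximal ideal (lemma [hdim1_neq0]). *)

Set Implicit Arguments.
Unset Strict Implicit.
Unset Printing Implicit Defensive.

Local Open Scope classical_set_scope.

(** * Monomial ideals *)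

Section MonomialIdeals.

Variables (n : nat) (K : fieldType).
Local Notation R := {mpoly K[n]}.
Implicit Types (S T : set 'X_{1..n}) (m : 'X_{1..n}) (p q : R) (s : seq 'X_{1..n}).

(** Membership is a condition on the support, which makes sums, products and
    colons of monomial ideals computations with exponents; lemma
    [idealgen_mideal] relates it to generation. *)
Definition mideal S : set R :=
  [set p | forall m, m \in msupp p -> exists2 m', S m' & (m' <= m)%MM].

Lemma mideal0 S : mideal S 0.
Proof. by move=> m; rewrite msupp0. Qed.

Lemma midealD S p q : mideal S p -> mideal S q -> mideal S (p + q).
Proof.
move=> Sp Sq m /msuppD_le; rewrite mem_cat => /orP[]; [exact: Sp | exact: Sq].
Qed.

Lemma midealM S p q : mideal S q -> mideal S (p * q).
Proof.
move=> Sq m /msuppM_le /allpairsP[[m1 m2] /= [_ m2q ->]].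
have [m' Sm' le_m'] := Sq _ m2q; exists m' => //.
exact: lepm_trans le_m' (lem_addl _ _).
Qed.

Lemma mideal_sum S (I : eqType) (r : seq I) (F : I -> R) :
  (forall i, i \in r -> mideal S (F i)) -> mideal S (\sum_(i <- r) F i).
Proof.
move=> SF; rewrite big_seq; elim/big_rec: _ => [|i p ri Sp]; first exact: mideal0.
by apply: midealD Sp; apply: SF.
Qed.

Lemma midealX S m : mideal S 'X_[m] <-> exists2 m', S m' & (m' <= m)%MM.
Proof.
split=> [|Sm m0]; first by apply; rewrite msuppX inE.
by rewrite msuppX inE => /eqP ->.
Qed.

Lemma mideal_eq S T :
  (forall m, S m -> exists2 m', T m' & (m' <= m)%MM) ->
  (forall m, T m -> exists2 m', S m' & (m' <= m)%MM) ->
  mideal S = mideal T.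
Proof.
move=> leST leTS; apply/seteqP; split=> p Sp m /Sp[m1 m1P le_m1].
  by have [m2 m2P le_m2] := leST _ m1P; exists m2 => //; apply: lepm_trans le_m1.
by have [m2 m2P le_m2] := leTS _ m1P; exists m2 => //; apply: lepm_trans le_m1.
Qed.

Lemma idealgen_mideal (G : set R) S :
  (forall m, S m -> G 'X_[m]) -> (forall f, G f -> mideal S f) ->
  idealgen G = mideal S.
Proof.
move=> SG GS; apply/seteqP; split=> [_ [s [sG ->]]|p Sp].
  by apply: mideal_sum => u us; apply/midealM/GS/sG.
pose f m := match pselect (exists2 m', S m' & (m' <= m)%MM) with
  | left e => xget 0%MM [set m' | S m' /\ (m' <= m)%MM] | right _ => 0%MM end.
have fP m : m \in msupp p -> S (f m) /\ (f m <= m)%MM.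
  move=> /Sp ex; rewrite /f; case: pselect => [_|//]; case: ex => m' Sm' le_m'.
  by case: xgetP => [m0 _ //|] /(_ m') [].
exists [seq (p@_m *: 'X_[m - f m], 'X_[f m]) | m <- msupp p]; split.
  by move=> _ /mapP[m mp ->] /=; apply: SG; case: (fP _ mp).
rewrite big_map {1}(mpolyE p) /= big_seq [RHS]big_seq; apply: eq_bigr => m mp.
by rewrite -mpoly_scaleAl -mpolyXD submK //; case: (fP _ mp).
Qed.

Lemma idealgen_mpolyX s :
  idealgen [set` [seq 'X_[m] | m <- s] : seq R] = mideal [set` s].
Proof.
apply: idealgen_mideal => [m ms|_ /mapP[m ms ->]]; first exact: map_f.
by apply/midealX; exists m => //; apply: lepm_refl.
Qed.

Lemma idealmul_mideal S T :
  idealmul (mideal S) (mideal T)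
  = mideal [set (m1 + m2)%MM | m1 in S & m2 in T].
Proof.
apply: idealgen_mideal => [_ [m1 Sm1 [m2 Tm2 <-]]|_ [p [q [Sp Tq ->]]]].
  exists 'X_[m1], 'X_[m2]; rewrite mpolyXD.
  by split=> //; apply/midealX; [exists m1|exists m2] => //; apply: lepm_refl.
move=> m /msuppM_le /allpairsP[[m1 m2] /= [m1p m2q ->]].
have [a Sa le_a] := Sp _ m1p; have [b Tb le_b] := Tq _ m2q.
exists (a + b)%MM; first by exists a => //; exists b.
by apply/mnm_lepP => i; rewrite !mnmDE leq_add //; apply/mnm_lepP.
Qed.

(** A polynomial of the sum splits along its support. *)
Lemma idealadd_mideal S T : idealadd (mideal S) (mideal T) = mideal (S `|` T).
Proof.
apply/seteqP; split=> [_ [a [b [Sa Tb ->]]]|p STp].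
  by apply/midealD => m; [move/Sa|move/Tb] => -[m' m'P le_m'];
    exists m' => //; [left|right].
pose P m := `[< exists2 m', S m' & (m' <= m)%MM >].
exists (\sum_(m <- msupp p | P m) p@_m *: 'X_[m]),
       (\sum_(m <- msupp p | ~~ P m) p@_m *: 'X_[m]); split; last first.
- by rewrite {1}(mpolyE p) (bigID P).
- rewrite -big_filter; apply: mideal_sum => m; rewrite mem_filter => /andP[nPm mp].
  rewrite -mul_mpolyC; apply: midealM; apply/midealX.
  have [m' [Sm'|Tm'] le_m'] := STp _ mp; last by exists m'.
  by case/negP: nPm; apply/asboolP; exists m'.
- rewrite -big_filter; apply: mideal_sum => m; rewrite mem_filter => /andP[Pm mp].
  by rewrite -mul_mpolyC; apply: midealM; apply/midealX/asboolP.
Qed.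

(** Multiplication by ['X_[m]] shifts the support, and [m' <= m + m0] means
    [m' - m <= m0]: the exponents [m' - m] are truncated differences, so that ['X_[m' - m]] is
    the quotient of ['X_[m']] by its greatest common divisor with ['X_[m]]. *)
Lemma mideal_colon S m p :
  mideal S (p * 'X_[m]) <-> mideal [set (m' - m)%MM | m' in S] p.
Proof.
have leE m' m0 : (m' <= m + m0)%MM = (m' - m <= m0)%MM.
  by apply/mnm_lepP/mnm_lepP => le i; move: (le i); rewrite mnmDE mnmBE; lia.
split=> Sp m0.
  move=> m0p; have [|m' Sm' le_m'] := Sp (m + m0)%MM.
    by rewrite (perm_mem (msuppMX _ _)) map_f.
  by exists (m' - m)%MM; [exists m'|rewrite -leE].
rewrite (perm_mem (msuppMX _ _)) => /mapP[m1 /Sp[_ [m' Sm' <-] le_m'] ->].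
by exists m'; rewrite ?leE.
Qed.

End MonomialIdeals.

(** * Linear quotients of monomial ideals *)

Section MonomialLinearQuotients.

Variables (n : nat) (K : fieldType).
Local Notation R := {mpoly K[n]}.
Implicit Types (m : 'X_{1..n}) (s : seq 'X_{1..n}) (vs : seq 'I_n).

Lemma lem_mdeg_eq m m' : (m' <= m)%MM -> mdeg m' = mdeg m -> m' = m.
Proof.
move=> le_m' eqd; have := submK le_m'; have := congr1 mdeg (submK le_m').
rewrite mdegD -eqd -[RHS]add0n => /addIn/eqP; rewrite mdeg_eq0 => /eqP -> <-.
by rewrite add0m.
Qed.

(** Linear quotients in terms of exponents: the truncated differences [s_i - s_j]
    for [i < j] generate the colon ideal at [s_j], so this ideal is generated by
    variables when each of them is divisible by one that is a variable. *)
Definition lin_quot s := forall i j, (i < j < size s)%N ->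
  exists l t, [/\ (l < j)%N, (nth 0 s l - nth 0 s j = U_(t))%MM
                & (U_(t) <= nth 0 s i - nth 0 s j)%MM].

Lemma lin_quot_uniq s : lin_quot s -> uniq s.
Proof.
move=> lq; apply/(uniqP 0%MM) => i j; rewrite !inE.
wlog lt_ij : i j / (i < j)%N => [th si sj eq_s|si sj eq_s].
  have [lt|lt|//] := ltngtP i j; first exact: th.
  by symmetry; apply: th.
have [|l [t [_ _]]] := lq i j; first by rewrite lt_ij.
by move/mnm_lepP/(_ t); rewrite mnm1E eqxx eq_s mnmBE subnn.
Qed.

Definition colon_vars s j : seq 'I_n :=
  [seq t <- enum 'I_n | (U_(t) \in [seq m - nth 0 s j | m <- take j s])%MM].

Lemma mideal_colon_vars s j : lin_quot s -> (j < size s)%N ->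
  mideal (n := n) (K := K) [set (m - nth 0 s j)%MM | m in [set` take j s]]
  = mideal [set` [seq U_(t)%MM | t <- colon_vars s j]].
Proof.
move=> lq lt_j; apply: mideal_eq => m /=; last first.
  move=> /mapP[t]; rewrite mem_filter => /andP[/mapP[m1 m1s ->] _ ->].
  by exists (m1 - nth 0 s j)%MM; [exists m1|apply: lepm_refl].
move=> [m1 m1s <-].
have lt_i : (index m1 (take j s) < j)%N.
  by move: m1s; rewrite -index_mem size_take lt_j.
have [|l [t [lt_l eq_t le_t]]] := lq (index m1 (take j s)) j.
  by rewrite lt_i.
exists U_(t)%MM; last first.
  by move: le_t; rewrite -[in X in X -> _](nth_take _ lt_i) nth_index.
apply/mapP; exists t => //; rewrite mem_filter mem_enum andbT.
apply/mapP; exists (nth 0%MM s l); last by [].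
by rewrite -(nth_take _ lt_l) mem_nth // size_take lt_j.
Qed.

(** Dividing a variable by another one does nothing, so each colon ideal is
    generated by the earlier variables. *)
Lemma lin_quot_vars vs : uniq vs -> lin_quot [seq U_(t)%MM | t <- vs].
Proof.
move=> uvs i j; rewrite size_map => /andP[lt_ij lt_j].
have lt_i := ltn_trans lt_ij lt_j.
have t0 : 'I_n by case: vs lt_j {uvs lt_i}.
have nz : (U_(nth t0 vs i) - U_(nth t0 vs j) = U_(nth t0 vs i))%MM.
  have ne : nth t0 vs i != nth t0 vs j by rewrite nth_uniq // ltn_eqF.
  apply/mnmP => a; rewrite mnmBE !mnm1E; case: eqP => [<-|_]; last by rewrite sub0n.
  by rewrite eq_sym (negPf ne).
exists i, (nth t0 vs i).
by rewrite !(nth_map t0) // nz; split=> //; apply: lepm_refl.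
Qed.

Lemma mdeg_vars vs m : m \in [seq U_(t)%MM | t <- vs] -> mdeg m = 1%N.
Proof. by move=> /mapP[t _ ->]; rewrite mdeg1. Qed.

Lemma lin_quot_linear_quotients s D :
  lin_quot s -> (forall m, m \in s -> mdeg m = D) ->
  linear_quotients (mideal [set` s] : set R).
Proof.
move=> lq sD; exists D, [seq 'X_[m] | m <- s]; split.
- by move=> f /mapP[m ms ->]; rewrite dhomogX; apply/eqP/sD.
- split; first exact: idealgen_mpolyX.
  move=> i; rewrite size_map => lt_i.
  rewrite -map_take -map_drop -map_cat idealgen_mpolyX => eqI.
  set m := nth 0%MM s i.
  have ms : m \in s by rewrite mem_nth.
  have : mideal [set` take i s ++ drop i.+1 s] ('X_[m] : R).
    by rewrite eqI; apply/midealX; exists m => //; apply: lepm_refl.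
  move/midealX => [m' /= m's le_m'].
  have m'E : m' = m.
    apply: lem_mdeg_eq le_m' _; rewrite (sD m) // sD //.
    by move: m's; rewrite mem_cat => /orP[/mem_take|/mem_drop].
  have := lin_quot_uniq lq; rewrite -(cat_take_drop i s) (drop_nth 0%MM lt_i).
  by rewrite -cat1s uniq_catCA cat1s cons_uniq -/m -m'E m's.
- move=> j; rewrite size_map => lt_j.
  exists [set` [seq 'X_t | t <- colon_vars s j] : seq R]; split.
    by move=> _ /mapP[t _ ->]; rewrite dhomogX; apply/eqP/mdeg1.
  have -> : [seq 'X_t | t <- colon_vars s j]
            = [seq 'X_[m] | m <- [seq U_(t)%MM | t <- colon_vars s j]] :> seq R.
    by rewrite -map_comp.
  rewrite idealgen_mpolyX -mideal_colon_vars // -map_take idealgen_mpolyX.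
  by apply/seteqP; split=> p; rewrite /idealcolon /= (nth_map 0%MM) // mideal_colon.
Qed.

End MonomialLinearQuotients.

(** * Monomial generators of the powers of J *)

Section PowersOfJ.

Implicit Types (m : 'X_{1..4}) (d k : nat).

Local Notation ix1 := (@Ordinal 4 0 isT).
Local Notation ix2 := (@Ordinal 4 1 isT).
Local Notation iz1 := (@Ordinal 4 2 isT).
Local Notation iz2 := (@Ordinal 4 3 isT).

Definition mon4 (a b u v : nat) : 'X_{1..4} := Multinom [tuple a; b; u; v].

Lemma mon4E a b u v :
  ((mon4 a b u v ix1 = a) * (mon4 a b u v ix2 = b)
  * (mon4 a b u v iz1 = u) * (mon4 a b u v iz2 = v))%type.
Proof. by rewrite !mnm_tnth. Qed.

Lemma forall_ord4 (P : 'I_4 -> Prop) :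
  P ix1 -> P ix2 -> P iz1 -> P iz2 -> forall i, P i.
Proof.
by move=> P0 P1 P2 P3 [[|[|[|[|i]]]] lti] //;
  [move: P0|move: P1|move: P2|move: P3]; congr P; apply: val_inj.
Qed.

Lemma mnm4_eq m m' : m ix1 = m' ix1 -> m ix2 = m' ix2 ->
  m iz1 = m' iz1 -> m iz2 = m' iz2 -> m = m'.
Proof. by move=> *; apply/mnmP; apply: forall_ord4. Qed.

Lemma mnm4_le m m' : (m ix1 <= m' ix1)%N -> (m ix2 <= m' ix2)%N ->
  (m iz1 <= m' iz1)%N -> (m iz2 <= m' iz2)%N -> (m <= m')%MM.
Proof. by move=> *; apply/mnm_lepP; apply: forall_ord4. Qed.

Lemma mdeg4 m : mdeg m = (m ix1 + m ix2 + m iz1 + m iz2)%N.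
Proof.
rewrite mdegE !big_ord_recl big_ord0 addn0 !addnA.
by congr (m _ + m _ + m _ + m _)%N; apply: val_inj.
Qed.

(** The exponents of the products of [k] generators of [J], for [k > 0]. With at least one
    factor from the powers of [(z_1, z_2)], the exponents of [z_1] and [z_2] are
    free above the bounds that the factors [x_2 z_1^(d-1) z_2] impose; without
    any, the exponent of [z_2] is determined by the numbers of factors
    [x_2 z_1^(d-1) z_2] and [x_1 z_2^d]. *)
Definition Jgen d k : set 'X_{1..4} :=
  [set m | [/\ (m ix1 + m ix2 <= k)%N,
               (m ix1 + m ix2 + m iz1 + m iz2 = k * d.+1)%N,
               (d.-1 * m ix2 <= m iz1)%N, (m ix2 <= m iz2)%N
             & (m ix1 + m ix2 = k)%N ->
               exists2 q, (q <= m ix1)%N & (m iz2 = m ix2 + d * q)%N]].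

Lemma Jgen_add d k m m' :
  Jgen d 1 m -> Jgen d k m' -> Jgen d k.+1 (m + m')%MM.
Proof.
move=> [le1 deg1 u1 v1 top1] [le2 deg2 u2 v2 top2]; rewrite /Jgen /= !mnmDE.
split; [lia|lia|lia|lia|move=> top].
have [|q1 leq1 q1E] := top1; first by lia.
have [|q2 leq2 q2E] := top2; first by lia.
by exists (q1 + q2)%N; [lia|rewrite mulnDr; lia].
Qed.

(** When a factor from [(z_1, z_2)^(d+1)] is present, it is the one to remove: the
    rest must stay above the bounds, and if it has no such factor left, the exponent
    of [z_2] in it must be of the form [r + d q], which can be reached as [d] is
    less than the length [d + 1] of the range of the removed exponent. *)
Lemma Jgen_split d k m : (0 < d)%N -> (0 < k)%N -> Jgen d k.+1 m ->
  exists m1 m2, [/\ Jgen d 1 m1, Jgen d k m2 & (m1 + m2)%MM = m].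
Proof.
move=> d_gt0 k_gt0 [lek deg u v top].
have dE b : (d.-1 * b = d * b - b)%N by rewrite -subn1 mulnBl mul1n.
have le_dM b : (b <= d * b)%N by rewrite leq_pmull.
have degE : (k.+1 * d.+1 = k * d + k + d.+1)%N by rewrite mulSn mulnSr; lia.
have degkE : (k * d.+1 = k * d + k)%N by rewrite mulnSr.
rewrite dE in u.
have split1 m1 : (m1 <= m)%MM -> Jgen d 1 m1 -> Jgen d k (m - m1)%MM ->
    exists m1 m2, [/\ Jgen d 1 m1, Jgen d k m2 & (m1 + m2)%MM = m].
  by move=> le_m1 *; exists m1, (m - m1)%MM; rewrite addmC submK.
have le1 := le_dM (m ix2).
have [topk|a_lek] : (m ix1 + m ix2 = k.+1)%N \/ (m ix1 + m ix2 <= k)%N by lia.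
  (* Only special generators: remove x_2 z_1^(d-1) z_2 if possible, else x_1 z_2^d
     if q > 0, else x_1 z_1^d. *)
  have [q leq vE] := top topk.
  have [r0|r_gt0] := posnP (m ix2); last first.
    have dr : (d * m ix2 = d * (m ix2).-1 + d)%N.
      by rewrite -mulnSr prednK.
    have dr' := le_dM (m ix2).-1.
    apply: (split1 (mon4 0 1 d.-1 1)).
    - by apply: mnm4_le; rewrite !mon4E; lia.
    - split; rewrite !mon4E //; try lia.
      by exists 0%N => //; rewrite muln0.
    - have d1 : (d * (m ix2 - 1) = d * (m ix2).-1)%N by rewrite subn1.
      split; rewrite !mnmBE !mon4E ?dE; try lia; move=> _.
      by exists q; lia.
  have [q0|q_gt0] := posnP q.
    apply: (split1 (mon4 1 0 d 0)).
    - by apply: mnm4_le; rewrite !mon4E; lia.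
    - split; rewrite !mon4E //; try lia.
      by exists 0%N => //; rewrite muln0.
    - split; rewrite !mnmBE !mon4E ?dE ?subn0 ?r0 ?muln0; try lia; move=> _.
      by exists 0%N; lia.
  case: q q_gt0 leq vE => // q _ leq; rewrite mulnSr => vE.
  apply: (split1 (mon4 1 0 0 d)).
  - by apply: mnm4_le; rewrite !mon4E; lia.
  - split; rewrite !mon4E //; try lia.
    by exists 1%N; rewrite ?muln1.
  - split; rewrite !mnmBE !mon4E ?dE ?subn0 ?r0 ?muln0; try lia; move=> _.
    by exists q; lia.
have drk : (d * m ix2 <= k * d)%N by rewrite mulnC leq_mul2r; lia.
have [a_k|a_ltk] : (m ix1 + m ix2 = k)%N \/ (m ix1 + m ix2 < k)%N by lia.
  (* The largest exponent r + d q of z_2 that the rest may have. *)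
  pose q := minn ((m iz2 - m ix2) %/ d) (m ix1).
  have leq : (q <= m ix1)%N by rewrite /q geq_minr.
  have dqv : (d * q <= m iz2 - m ix2)%N.
    apply: (@leq_trans (d * ((m iz2 - m ix2) %/ d))); last by rewrite mulnC leq_trunc_div.
    by rewrite leq_mul2l geq_minl orbT.
  have dv : (m iz2 - m ix2 < d * q + d \/ q = m ix1)%N.
    rewrite /q; case: (leqP (_ %/ d) (m ix1)) => _; last by right.
    by left; rewrite -mulnSr mulnC ltn_ceil.
  clearbody q; have dq : (d * q <= d * m ix1)%N by rewrite leq_mul2l leq orbT.
  have dE3 : (k * d = d * m ix1 + d * m ix2)%N by rewrite -a_k; nia.
  pose v1 := (m iz2 - (m ix2 + d * q))%N.
  have v1_le : (v1 <= d.+1)%N.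
    rewrite /v1; case: dv => [|qE]; first lia.
    by rewrite qE; lia.
  apply: (split1 (mon4 0 0 (d.+1 - v1) v1)).
  - by apply: mnm4_le; rewrite !mon4E; rewrite /v1 in v1_le *; lia.
  - by split; rewrite !mon4E //; lia.
  - split; rewrite !mnmBE !mon4E ?dE ?subn0; [lia| | | |].
    + by rewrite /v1 in v1_le *; lia.
    + by rewrite /v1 in v1_le *; lia.
    + by rewrite /v1; lia.
    + by move=> _; exists q => //; rewrite /v1; lia.
(* The rest has a factor from (z_1, z_2)^(d+1) too: remove as many z_1 as possible. *)
pose s := minn d.+1 (m iz1 - d.-1 * m ix2).
have s_le1 : (s <= d.+1)%N by rewrite geq_minl.
have s_le2 : (s <= m iz1 - d.-1 * m ix2)%N by rewrite geq_minr.
have sE : (s = d.+1 \/ s = m iz1 - d.-1 * m ix2)%N.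
  by rewrite /s; case: (leqP d.+1); [left|right].
rewrite dE in s_le2 sE.
apply: (split1 (mon4 0 0 s (d.+1 - s))).
- by apply: mnm4_le; rewrite !mon4E; lia.
- by split; rewrite !mon4E //; lia.
- by split; rewrite !mnmBE !mon4E ?dE ?subn0; lia.
Qed.

Variable K : fieldType.

Lemma powers_z12 e :
  idealexp (idealgen [set` [:: z1 K; z2 K]]) e
  = mideal [set m | [/\ m ix1 = 0, m ix2 = 0 & m iz1 + m iz2 = e]%N].
Proof.
have -> : idealgen [set` [:: z1 K; z2 K]]
          = mideal [set` [:: mon4 0 0 1 0; mon4 0 0 0 1]].
  rewrite -idealgen_mpolyX /=.
  have -> : mon4 0 0 1 0 = U_(iz1)%MM by apply: mnm4_eq; rewrite !mon4E mnm1E.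
  by have -> : mon4 0 0 0 1 = U_(iz2)%MM by apply: mnm4_eq; rewrite !mon4E mnm1E.
elim: e => [|e IH] /=.
  apply/seteqP; split=> p // _ m _.
  exists 0%MM; first by rewrite /= !mnm0E.
  by apply/mnm_lepP => i; rewrite mnm0E.
rewrite IH idealmul_mideal; congr mideal; apply/seteqP; split=> m /=.
  move=> [m1 m1z [m2 [m20 m21 m2e] <-]]; rewrite !mnmDE m20 m21.
  by move: m1z; rewrite !inE => /orP[]/eqP ->; rewrite !mon4E; split=> //; lia.
move=> [m0 m1 me]; have [u0|u_gt0] := posnP (m iz1).
  exists (mon4 0 0 0 1); first by rewrite !inE eqxx orbT.
  exists (m - mon4 0 0 0 1)%MM; first by rewrite !mnmBE !mon4E; split; lia.
  by rewrite addmC submK //; apply: mnm4_le; rewrite !mon4E; lia.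
exists (mon4 0 0 1 0); first by rewrite !inE eqxx.
exists (m - mon4 0 0 1 0)%MM; first by rewrite !mnmBE !mon4E; split; lia.
by rewrite addmC submK //; apply: mnm4_le; rewrite !mon4E; lia.
Qed.

Lemma idealJE d : (0 < d)%N -> idealJ K d = mideal (Jgen d 1).
Proof.
move=> d_gt0; rewrite /idealJ powers_z12.
have -> : [:: x1 K * z1 K ^+ d; x1 K * z2 K ^+ d; x2 K * z1 K ^+ d.-1 * z2 K]
  = [seq 'X_[m] | m <- [:: mon4 1 0 d 0; mon4 1 0 0 d; mon4 0 1 d.-1 1]].
  rewrite /= /x1 /x2 /z1 /z2 !mpolyXn -!mpolyXD.
  have -> : (U_(ix1) + U_(iz1) *+ d)%MM = mon4 1 0 d 0.
    by apply: mnm4_eq; rewrite !mon4E !mnmDE ?mulmnE !mnm1E /=; lia.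
  have -> : (U_(ix1) + U_(iz2) *+ d)%MM = mon4 1 0 0 d.
    by apply: mnm4_eq; rewrite !mon4E !mnmDE ?mulmnE !mnm1E /=; lia.
  suff -> : (U_(ix2) + U_(iz1) *+ d.-1 + U_(iz2))%MM = mon4 0 1 d.-1 1 by [].
  by apply: mnm4_eq; rewrite !mon4E !mnmDE ?mulmnE !mnm1E /=; lia.
rewrite idealgen_mpolyX idealadd_mideal; congr mideal.
apply/seteqP; split=> m /=.
  rewrite !inE => -[/or3P[]/eqP->|[m0 m1 me]].
  - split; rewrite !mon4E //; try lia.
    by exists 0%N => //; rewrite muln0.
  - split; rewrite !mon4E //; try lia.
    by exists 1%N; rewrite ?muln1.
  - split; rewrite !mon4E //; try lia.
    by exists 0%N => //; rewrite muln0.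
  - by split; rewrite ?m0 ?m1; lia.
move=> [le1 deg u v top].
have [a0|a1] : (m ix1 + m ix2 = 0)%N \/ (m ix1 + m ix2 = 1)%N by lia.
  by right; split; lia.
have [q leq vE] := top a1; left; rewrite !inE.
have [r0|r1] : (m ix2 = 0)%N \/ (m ix2 = 1)%N by lia.
  have [q0|q1] : (q = 0)%N \/ (q = 1)%N by lia.
    apply/or3P/Or31/eqP; move: vE; rewrite q0 muln0 => vE.
    by apply: mnm4_eq; rewrite !mon4E; lia.
  apply/or3P/Or32/eqP; move: vE; rewrite q1 muln1 => vE.
  by apply: mnm4_eq; rewrite !mon4E; lia.
have q0 : q = 0%N by lia.
apply/or3P/Or33/eqP; move: vE; rewrite q0 muln0 => vE.
by apply: mnm4_eq; rewrite !mon4E; lia.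
Qed.

Lemma idealexpJE d k : (0 < d)%N -> (0 < k)%N ->
  idealexp (idealJ K d) k = mideal (Jgen d k).
Proof.
move=> d_gt0; case: k => // k _; elim: k => [|k IH].
  rewrite /= idealJE // -[setT]/(idealexp (mideal (Jgen d 1)) 0).
  have -> : idealexp (mideal (Jgen d 1)) 0 = mideal [set 0%MM] :> set {mpoly K[4]}.
    apply/seteqP; split=> p // _ m _; exists 0%MM => //.
    by apply/mnm_lepP => i; rewrite mnm0E.
  rewrite idealmul_mideal; congr mideal; apply/seteqP; split=> m /=.
    by move=> [m1 m1J [m2 -> <-]]; rewrite addm0.
  by move=> mJ; exists m => //; exists 0%MM => //; rewrite addm0.
have -> : idealexp (idealJ K d) k.+2
          = idealmul (idealJ K d) (idealexp (idealJ K d) k.+1) by [].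
rewrite IH idealJE // idealmul_mideal.
congr mideal; apply/seteqP; split=> m /=.
  by move=> [m1 m1J [m2 m2J <-]]; apply: Jgen_add.
move=> /Jgen_split[] // m1 [m2 [m1J m2J <-]].
by exists m1 => //; exists m2.
Qed.

(** The order of the generators: the factor of the degree in [x_1, x_2] exceeds the
    sum of the other two exponents, so that this degree is compared first. *)
Definition Jkey d k m : nat :=
  ((m ix1 + m ix2) * (2 * (k * d.+1)).+1 + m ix2 + m iz2)%N.

Lemma subm4 m m' (t : 'I_4) :
  (forall i, i != t -> m i <= m' i)%N -> m t = (m' t).+1 ->
  (m - m')%MM = U_(t)%MM.
Proof.
move=> le_m m_t; apply/mnmP => i; rewrite mnmBE mnm1E eq_sym.
by have [->|/le_m] := eqVneq i t; lia.
Qed.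

(** The generator [h] comes from [f] by an exchange: one [z_2] for [z_1] in the
    absence of [x]'s, an [x] for the [z] that [g] has in excess, and otherwise one
    [x_2] for [x_1]. The hypothesis [k < d] excludes two generators of degree [k] in
    [x_1, x_2] with the same exponent of [z_2]. *)
Lemma Jgen_neighbor d k f g : (0 < k < d)%N -> Jgen d k f -> Jgen d k g ->
  (Jkey d k g <= Jkey d k f)%N -> g != f ->
  exists h t, [/\ Jgen d k h, (Jkey d k h < Jkey d k f)%N,
                  (h - f)%MM = U_(t)%MM & (U_(t) <= g - f)%MM].
Proof.
move=> /andP[k_gt0 ltkd] [leF degF uF vF topF] [leG degG uG vG topG] leGF neq.
have dE b : (d.-1 * b = d * b - b)%N by rewrite -subn1 mulnBl mul1n.
have le_dM b : (b <= d * b)%N by rewrite leq_pmull; lia.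
have dS b : (d * b.+1 = d * b + d)%N by rewrite mulnSr.
have U t : (f t < g t)%N -> (U_(t) <= g - f)%MM by rewrite lep1mP mnmBE; lia.
move: uF uG leGF; rewrite /Jkey !dE; set D := (k * d.+1)%N in degF degG *.
set aF := (f ix1 + f ix2)%N in leF degF topF *.
set aG := (g ix1 + g ix2)%N in leG degG topG *.
move=> uF uG leGF.
have D_gt0 : (0 < D)%N by rewrite /D muln_gt0 k_gt0.
have aFS a : ((a.+1) * (2 * D).+1 = a * (2 * D).+1 + (2 * D).+1)%N by rewrite mulSn addnC.
have le_aGF : (aG <= aF)%N.
  rewrite leqNgt; apply/negP => lt.
  have : (aF.+1 * (2 * D).+1 <= aG * (2 * D).+1)%N by rewrite leq_mul2r lt orbT.
  by rewrite aFS; lia.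
have [aF0|aF_gt0] := posnP aF.
  have aG0 : aG = 0%N by lia.
  rewrite aG0 aF0 !mul0n in leGF.
  have lt_v : (g iz2 < f iz2)%N.
    rewrite ltn_neqAle; apply/andP; split; last by lia.
    apply: contra_neq neq => eqv; apply: mnm4_eq; lia.
  exists (mon4 0 0 (f iz1).+1 (f iz2).-1), iz1; split.
  - by split; rewrite !mon4E ?dE ?muln0 -/D; lia.
  - by rewrite /Jkey !mon4E; lia.
  - apply: subm4; rewrite ?mon4E //; apply: forall_ord4; rewrite !mon4E //; lia.
  - by apply: U; lia.
have low (t : 'I_4) : t = iz1 \/ t = iz2 -> (f t < g t)%N ->
    exists h t, [/\ Jgen d k h, (Jkey d k h < aF * (2 * D).+1 + f ix2 + f iz2)%N,
                    (h - f)%MM = U_(t)%MM & (U_(t) <= g - f)%MM].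
  move=> tE lt_t.
  have [c1 [c2 cE]] : exists c1 c2,
      t = iz1 /\ c1 = 1%N /\ c2 = 0%N \/ t = iz2 /\ c1 = 0%N /\ c2 = 1%N.
    by case: tE => ->; [exists 1%N, 0%N; left|exists 0%N, 1%N; right].
  (* The variable to exchange is x_1 if it occurs, else x_2. *)
  have [x0|x_gt0] := posnP (f ix1).
    case r_eq: (f ix2) => [|r]; first lia.
    have le_dr := le_dM r.
    exists (mon4 0 r (f iz1 + c1) (f iz2 + c2)), t; split.
    + by split; rewrite !mon4E ?dE; move: uF; rewrite ?r_eq ?dS -/D; lia.
    + rewrite /Jkey !mon4E -/D; have -> : aF = r.+1 by lia.
      by rewrite aFS add0n; lia.
    + apply: subm4.
        by apply: forall_ord4; rewrite !mon4E; case: cE => -[? [? ?]]; subst t c1 c2 => //; lia.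
      by case: cE => -[? [? ?]]; subst t c1 c2; rewrite !mon4E; lia.
    + exact: U.
  exists (mon4 (f ix1).-1 (f ix2) (f iz1 + c1) (f iz2 + c2)), t; split.
  + by split; rewrite !mon4E ?dE -/D; lia.
  + rewrite /Jkey !mon4E -/D; have -> : aF = ((f ix1).-1 + f ix2).+1 by lia.
    by rewrite aFS; lia.
  + apply: subm4.
      by apply: forall_ord4; rewrite !mon4E; case: cE => -[? [? ?]]; subst t c1 c2 => //; lia.
    by case: cE => -[? [? ?]]; subst t c1 c2; rewrite !mon4E; lia.
  + exact: U.
have [lt_u|le_u] := ltnP (f iz1) (g iz1); first by apply: (low iz1) => //; left.
have [lt_v|le_v] := ltnP (f iz2) (g iz2); first by apply: (low iz2) => //; right.
have eq_a : aG = aF by lia.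
have lt_r : (g ix2 < f ix2)%N.
  rewrite ltn_neqAle; apply/andP; split; last by move: leGF; rewrite eq_a; lia.
  apply: contra_neq neq => eqv; apply: mnm4_eq; lia.
have [aFk|lt_a] : aF = k \/ (aF < k)%N by lia.
  have [q1 leq1 vE1] := topF aFk; have [|q2 leq2 vE2] := topG; first by lia.
  have : ((f ix2 + d * q1) %% d = (g ix2 + d * q2) %% d)%N.
    by rewrite -vE1 -vE2; congr (_ %% _)%N; lia.
  by rewrite !(mulnC d) !(addnC _ (_ * d)%N) !modnMDl !modn_small; lia.
case r_eq: (f ix2) lt_r => [//|r] lt_r; have le_dr := le_dM r.
exists (mon4 (f ix1).+1 r (f iz1) (f iz2)), ix1; split.
- by split; rewrite !mon4E ?dE; move: uF; rewrite ?r_eq ?dS -/D; lia.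
- rewrite /Jkey !mon4E -/D; have -> : aF = ((f ix1).+1 + r)%N by lia.
  by lia.
- apply: subm4; last by rewrite mon4E.
  by apply: forall_ord4; rewrite !mon4E => //; lia.
- by apply: U; lia.
Qed.

Definition Jlist d k : seq 'X_{1..4} :=
  sort (fun m m' => Jkey d k m <= Jkey d k m')%N
    [seq m <- [seq bmnm m | m : 'X_{1..4 < (k * d.+1).+1}] | `[< Jgen d k m >]].

Lemma mdeg_Jgen d k m : Jgen d k m -> mdeg m = (k * d.+1)%N.
Proof. by case=> _ deg _ _ _; rewrite mdeg4. Qed.

Lemma mem_Jlist d k m : (m \in Jlist d k) = `[< Jgen d k m >].
Proof.
rewrite mem_sort mem_filter andb_idr // => /asboolP mJ.
have lt_m : (mdeg m < (k * d.+1).+1)%N by rewrite (mdeg_Jgen mJ).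
by apply/mapP; exists (BMultinom lt_m); rewrite ?mem_enum.
Qed.

Lemma lin_quot_Jlist d k : (0 < k < d)%N -> lin_quot (Jlist d k).
Proof.
move=> ltk i j /andP[lt_ij lt_j]; have lt_i := ltn_trans lt_ij lt_j.
have J_nth l : (l < size (Jlist d k))%N -> Jgen d k (nth 0%MM (Jlist d k) l).
  by move=> lt_l; apply/asboolP; rewrite -mem_Jlist mem_nth.
have le_key a b : (a <= b < size (Jlist d k))%N ->
    (Jkey d k (nth 0%MM (Jlist d k) a) <= Jkey d k (nth 0%MM (Jlist d k) b))%N.
  move=> /andP[le_ab lt_b]; have lt_a := leq_ltn_trans le_ab lt_b.
  apply: (@sorted_leq_nth _ (fun m m' => Jkey d k m <= Jkey d k m')%N) => //.
  - by move=> ? ? ?; apply: leq_trans.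
  - by apply: sort_sorted => ? ?; apply: leq_total.
have uJ : uniq (Jlist d k).
  by rewrite sort_uniq filter_uniq // map_inj_uniq ?enum_uniq //; apply: val_inj.
have [||h [t [hJ lt_h eq_t le_t]]] :=
  Jgen_neighbor ltk (J_nth _ lt_j) (J_nth _ lt_i).
- by apply: le_key; rewrite ltnW.
- by rewrite nth_uniq // ltn_eqF.
have h_in : h \in Jlist d k by rewrite mem_Jlist; apply/asboolP.
exists (index h (Jlist d k)), t; rewrite nth_index //; split=> //.
rewrite ltnNge; apply/negP => le_j; move: lt_h; rewrite ltnNge => /negP; apply.
by rewrite -[in X in (_ <= X)%N](nth_index 0%MM h_in) le_key // le_j index_mem.
Qed.

Lemma mideal_Jlist d k : mideal (K := K) [set` Jlist d k] = mideal (Jgen d k).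
Proof.
by congr mideal; apply/seteqP; split=> m /=; rewrite mem_Jlist => /asboolP.
Qed.

(** The factorizations of [x_1^d x_2^d z_1^(d(d-1)) z_2^d] through the
    generators [x_1^d w] and [x_2^d w] of [J^d], with [w = z_1^(d(d-1)) z_2^d],
    are not linked: no monomial of [J^d] has a cofactor in it that is divisible
    by [x_1] and by another variable. *)
Lemma Jgen_top_disconnected d m b i : (1 < d)%N -> Jgen d d m ->
  (m + b <= mon4 d d (d * d.-1) d)%MM -> b ix1 != 0%N -> i != ix1 -> b i = 0%N.
Proof.
move=> d_gt1 [led deg _ _ top] le_b b1.
have dd : (d * d.-1 = d * d - d)%N by rewrite -subn1 mulnBr muln1.
have le_dd : (d <= d * d)%N by rewrite leq_pmull; lia.
move: deg; rewrite mulnSr => deg.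
have /mnm_lepP le := le_b.
have := le ix1; have := le ix2; have := le iz1; have := le iz2.
rewrite !mnmDE !mon4E dd => le_v le_u le_x2 le_x1.
have [|q leq vE] := top; first by lia.
have q0 : q = 0%N.
  have [//|q_gt0] := posnP q.
  have : (d <= d * q)%N by rewrite leq_pmulr.
  lia.
move: vE; rewrite q0 muln0 => vE; move: i.
by apply: forall_ord4 => //; lia.
Qed.

Lemma Jgen_top d : (1 < d)%N ->
  Jgen d d (mon4 d 0 (d * d.-1) d) /\ Jgen d d (mon4 0 d (d * d.-1) d).
Proof.
move=> d_gt1; have dd : (d * d.-1 = d * d - d)%N by rewrite -subn1 mulnBr muln1.
have dd' : (d.-1 * d = d * d - d)%N by rewrite mulnC.
have le_dd : (d <= d * d)%N by rewrite leq_pmull; lia.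
have dS : (d * d.+1 = d * d + d)%N by rewrite mulnSr.
split; split; rewrite !mon4E ?dd ?dd' ?dS; try lia; move=> _.
  by exists 1%N; lia.
by exists 0%N; lia.
Qed.

End PowersOfJ.

(** * Graded free resolutions by leading ideals *)

Section HomogeneousParts.

Variables (n : nat) (K : fieldType).
Local Notation R := {mpoly K[n]}.

Lemma pihomogMr (p q : R) (e j : nat) : q \is e.-homog ->
  pihomog mdeg j (p * q) = if (e <= j)%N then pihomog mdeg (j - e) p * q else 0.
Proof.
move=> hq; pose k := maxn (msize p) (j - e).+1.
rewrite {1}(@pihomog_partitionE _ _ mdeg k p) ?leq_maxl // mulr_suml raddf_sum /=.
have hM (i : 'I_k) : pihomog mdeg i p * q \is (i + e).-homog.
  by rewrite dhomogM // pihomogP.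
case: leqP => [le_ej|lt_je]; last first.
  apply: big1 => i _; apply: (pihomog_ne0 _ (hM i)).
  by rewrite gtn_eqF // ltn_addl.
have lt_k : (j - e < k)%N by rewrite leq_maxr.
rewrite (bigD1 (Ordinal lt_k)) //= big1 ?addr0 => [|i ne_i].
  by rewrite pihomog_dE // -{2}(subnK le_ej) (hM (Ordinal lt_k)).
apply: (pihomog_ne0 _ (hM i)); apply: contra ne_i => /eqP ij.
by rewrite -val_eqE /= -ij addnK.
Qed.

Variable r : nat.
Implicit Types (sh : 'I_r -> nat) (u v w : 'rV[R]_r).

Definition ghomog sh (j : nat) u := forall b,
  if (sh b <= j)%N then u 0 b \is (j - sh b).-homog else u 0 b == 0.

Definition hcomp sh j u : 'rV[R]_r :=
  \row_b if (sh b <= j)%N then pihomog mdeg (j - sh b) (u 0 b) else 0.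

Lemma hcompP sh j u : ghomog sh j (hcomp sh j u).
Proof. by move=> b; rewrite mxE; case: (sh b <= j)%N => //; apply: pihomogP. Qed.

Lemma hcomp_id sh j u : ghomog sh j u -> hcomp sh j u = u.
Proof.
move=> hu; apply/rowP => b; rewrite mxE; have := hu b.
by case: (sh b <= j)%N => [|/eqP ->] //; apply: pihomog_dE.
Qed.

End HomogeneousParts.

Section Syzygies.

Variables (n : nat) (K : fieldType).
Local Notation R := {mpoly K[n]}.
Implicit Types (r s : nat) (t : seq 'X_{1..n}).

Lemma hcomp_mul r s (sh : 'I_r -> nat) (sh' : 'I_s -> nat) j (B : 'M[R]_(s, r))
    (v : 'rV[R]_s) :
  (forall a, ghomog sh (sh' a) (row a B)) ->
  hcomp sh j (v *m B) = hcomp sh' j v *m B.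
Proof.
move=> hB; apply/rowP => b; rewrite !mxE.
have E a : (if (sh b <= j)%N then pihomog mdeg (j - sh b) (v 0 a * B a b) else 0)
    = (if (sh' a <= j)%N then pihomog mdeg (j - sh' a) (v 0 a) else 0) * B a b.
  have := hB a b; rewrite !mxE; case: (leqP (sh b) (sh' a)) => [le_ba hBab|_ /eqP ->].
    rewrite (pihomogMr _ _ hBab); case: (leqP (sh b) j) => [le_bj|lt_jb].
      have -> : (sh' a - sh b <= j - sh b)%N = (sh' a <= j)%N by lia.
      case: leqP => [le_aj|_]; last by rewrite mul0r.
      by congr (pihomog _ _ _ * _); lia.
    by rewrite leqNgt (leq_trans lt_jb le_ba) mul0r.
  by rewrite !mulr0 raddf0 if_same.
case: ifP => le_bj.
  by rewrite raddf_sum; apply: eq_bigr => a _; rewrite mxE /= -E le_bj.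
by rewrite big1 // => a _; rewrite mxE -E le_bj.
Qed.

Definition submod r (N : set 'rV[R]_r) :=
  N 0 /\ forall a u v, N u -> N v -> N (a *: u + v).

Definition graded r (sh : 'I_r -> nat) (N : set 'rV[R]_r) :=
  forall j u, N u -> N (hcomp sh j u).

(** The ideal of the leading coefficients at position [k], for the order in
    which a later position dominates the earlier ones. *)
Definition lead r (N : set 'rV[R]_r) (k : 'I_r) : set R :=
  [set p | exists w, [/\ N w, forall j : 'I_r, (k < j)%N -> w 0 j = 0 & w 0 k = p]].

(** The boolean [lin] selects between arbitrary monomial ideals and those with
    linear quotients in degree [e], so that one construction yields the existence
    of resolutions and of linear ones. *)
Definition admissible (lin : bool) (e : nat) t :=
  lin -> lin_quot t /\ forall m, m \in t -> mdeg m = e.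

Definition mono_lead lin e r (N : set 'rV[R]_r) :=
  forall k, exists2 t, admissible lin e t & lead N k = mideal [set` t].

Definition syz s r (B : 'M[R]_(s, r)) : set 'rV[R]_s := [set v | v *m B = 0].

Lemma submod_syz s r (B : 'M[R]_(s, r)) : submod (syz B).
Proof.
split=> [|a u v]; rewrite /syz /= ?mul0mx // => uB vB.
by rewrite mulmxDl -scalemxAl uB vB scaler0 addr0.
Qed.

Lemma graded_syz s r (B : 'M[R]_(s, r)) (sh : 'I_r -> nat) (sh' : 'I_s -> nat) :
  (forall a, ghomog sh (sh' a) (row a B)) -> graded sh' (syz B).
Proof.
move=> hB j u uB; rewrite /syz /= -(hcomp_mul _ _ hB).
by rewrite uB; apply/rowP => b; rewrite !mxE raddf0 if_same.
Qed.

(** Both classes of monomial ideals are closed under the colons that occur; the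
    colons of an ideal with linear quotients are generated in degree [1], whatever
    its own degree. *)
Lemma colon_list lin e t l : admissible lin e t -> (l < size t)%N ->
  exists2 t', admissible lin 1 t' &
    [set p : R | mideal [set` take l t] (p * 'X_[nth 0%MM t l])] = mideal [set` t'].
Proof.
move=> adm lt_l; case: lin adm => [adm|_].
  have [lq _] := adm isT; exists [seq U_(v)%MM | v <- colon_vars t l].
    split; last exact: mdeg_vars.
    by apply/lin_quot_vars/filter_uniq/enum_uniq.
  rewrite -mideal_colon_vars //; apply/seteqP.
  by split=> p /mideal_colon.
exists [seq (m - nth 0 t l)%MM | m <- take l t] => //.
have -> : [set` [seq (m - nth 0 t l)%MM | m <- take l t]]
    = [set (m - nth 0 t l)%MM | m in [set` take l t]].
  by apply/seteqP; split=> m /= => [/mapP[m' m's ->]|[m' m's <-]]; [exists m'|apply: map_f].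
by apply/seteqP; split=> p /mideal_colon.
Qed.

Lemma mideal_rcons t m (p : R) : mideal [set` rcons t m] p ->
  exists q c, mideal [set` t] q /\ p = q + c * 'X_[m].
Proof.
have -> : [set` rcons t m] = [set` t] `|` [set` [:: m]].
  apply/seteqP; split=> x /=; rewrite mem_rcons !inE.
    by move=> /orP[]->; [right|left].
  by move=> [->|->]; rewrite ?orbT.
rewrite -idealadd_mideal -(idealgen_mpolyX _ [:: m]).
move=> [q [_ [tq [s [sm ->]] ->]]].
exists q, (\sum_(u <- s) u.1); split=> //; congr (q + _).
rewrite mulr_suml big_seq [RHS]big_seq; apply: eq_bigr => u /sm /=.
by rewrite inE => /eqP ->.
Qed.

Section Generators.

Variables (lin : bool) (e c r : nat) (sh : 'I_r -> nat).

Definition good_gens (N : set 'rV[R]_r) :=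
  exists s (B : 'M[R]_(s, r)) (sh' : 'I_s -> nat),
    [/\ forall a, ghomog sh (sh' a) (row a B),
        forall w, N w <-> exists v, w = v *m B,
        mono_lead lin 1 (syz B)
      & lin -> forall a, sh' a = (c + e)%N].

Lemma good_gens0 : good_gens [set 0].
Proof.
exists 0%N, 0, (fun=> 0%N); split=> [[]//|w|[]//|_ []//].
split=> [->|[v ->]]; last by rewrite mulmx0.
by exists 0; rewrite mulmx0.
Qed.

(** Over the new last generator, the leading ideal of the syzygies is the colon
    ideal; the leading ideals at the earlier positions do not change. *)
Lemma good_gensS (N : set 'rV[R]_r) (b : 'rV[R]_r) j t :
  good_gens N -> ghomog sh j b -> (lin -> j = (c + e)%N) ->
  admissible lin 1 t -> [set p | N (p *: b)] = mideal [set` t] ->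
  good_gens [set w | exists u p, N u /\ w = u + p *: b].
Proof.
move=> [s [B [sh' [hB NB leadB shE]]]] hb jE admt colE.
pose sh2 (a : 'I_(s + 1)) := match split a with inl a => sh' a | inr _ => j end.
exists (s + 1)%N, (col_mx B b), sh2; split.
- move=> a; rewrite /sh2; case: split_ordP => a' ->.
    by rewrite rowKu; apply: hB.
  by rewrite rowKd ord1 row_id.
- move=> w; split=> [[u [p [/NB[v ->] ->]]]|[v ->]].
    by exists (row_mx v p%:M); rewrite mul_row_col mul_scalar_mx.
  exists (lsubmx v *m B), (rsubmx v 0 0); split; first by apply/NB; eexists.
  by rewrite -{1}(hsubmxK v) mul_row_col {1}[rsubmx v]mx11_scalar mul_scalar_mx.
- move=> k; case: (split_ordP k) => a ->{k}.
    have [t' admt' leadE] := leadB a; exists t' => //; rewrite -leadE.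
    apply/seteqP; split=> p [w [wB w0 <-]].
      exists (lsubmx w); split; last by rewrite mxE.
        have := wB; rewrite /syz /= -{1}(hsubmxK w) mul_row_col.
        suff -> : rsubmx w = 0 by rewrite mul0mx addr0.
        apply/rowP => i; rewrite !mxE w0 //=; case: a {wB w0 leadE} => a lta /=.
        by rewrite (ltn_addr _ lta).
      by move=> i lt_ai; rewrite mxE w0.
    exists (row_mx w 0); split; last by rewrite row_mxEl.
      by rewrite /syz /= mul_row_col mul0mx addr0.
    move=> i; case: (split_ordP i) => i' ->; first by rewrite row_mxEl; apply: w0.
    by rewrite row_mxEr mxE.
  exists t => //; rewrite -colE; apply/seteqP; split=> p /=.
    move=> [w [wB _ <-]]; apply/NB; exists (- lsubmx w); rewrite mulNmx.
    apply/eqP; rewrite -subr_eq0 opprK addrC; apply/eqP; move: wB.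
    rewrite /syz /= -{1}(hsubmxK w) mul_row_col {1}[rsubmx w]mx11_scalar.
    by rewrite mul_scalar_mx mxE ord1.
  move=> /NB[v vE]; exists (row_mx (- v) p%:M); split.
  + by rewrite /syz /= mul_row_col mulNmx mul_scalar_mx vE addNr.
  + by move=> i lt_i; have := ltn_ord i; move: lt_i; rewrite /= ord1; lia.
  + by rewrite row_mxEr ord1 mxE eqxx.
- move=> lin_ a; rewrite /sh2; case: split_ordP => a' _; first exact: shE.
  exact: jE.
Qed.

(** As in Schreyer's theorem on syzygies: adding the generators by increasing
    leading position, and at each position in the order of the monomials that
    generate the leading ideal, only adds syzygies whose leading ideals are colon
    ideals of monomials. *)
Theorem mono_lead_gens (N : set 'rV[R]_r) :
  submod N -> graded sh N -> mono_lead lin e N ->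
  (lin -> forall b, sh b = c) -> good_gens N.
Proof.
move=> [N0 NL] gN leadN shc.
pose M k := [set w | N w /\ forall j : 'I_r, (k <= j)%N -> w 0 j = 0].
suff GM k : (k <= r)%N -> good_gens (M k).
  suff -> : N = M r by apply: GM.
  apply/seteqP; split=> w; last by case.
  by move=> Nw; split=> // j; rewrite leqNgt ltn_ord.
elim: k => [_|k IH lt_kr].
  have -> : M 0%N = [set 0]; last exact: good_gens0.
  apply/seteqP; split=> w /= => [[_ w0]|->].
    by apply/rowP => j; rewrite w0 // mxE.
  by split=> // j _; rewrite mxE.
pose k' := Ordinal lt_kr; have [t admt leadE] := leadN k'.
pose Mt l := [set w | [/\ N w, forall j : 'I_r, (k < j)%N -> w 0 j = 0
                      & mideal [set` take l t] (w 0 k')]].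
suff GMt l : (l <= size t)%N -> good_gens (Mt l).
  suff -> : M k.+1 = Mt (size t) by apply: GMt.
  apply/seteqP; split=> w /=; last by case.
  move=> [Nw w0]; split=> //.
  by rewrite take_size -leadE; exists w.
elim: l => [_|l IHl lt_l].
  suff -> : Mt 0%N = M k by apply/IH/ltnW.
  apply/seteqP; split=> w /=.
    move=> [Nw w0 wk]; split=> // j; rewrite leq_eqVlt => /orP[/eqP kj|/w0//].
    have -> : j = k' by apply: val_inj.
    apply/mpolyP => m; rewrite mcoeff0; apply: memN_msupp_eq0; apply/negP.
    by move=> /wk[m']; rewrite take0.
  move=> [Nw w0]; split=> // [j /ltnW/w0//|].
  by rewrite w0 /=; [apply: mideal0|].
set m := nth 0%MM t l; have mt : m \in t by rewrite mem_nth.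
have : lead N k' 'X_[m].
  by rewrite leadE; apply/midealX; exists m => //; apply: lepm_refl.
move=> [w [Nw w0 wk]]; pose b := hcomp sh (mdeg m + sh k') w.
have hb : ghomog sh (mdeg m + sh k') b by apply: hcompP.
have Nb : N b by apply: gN.
have bk : b 0 k' = 'X_[m].
  rewrite mxE leq_addl addnK wk pihomog_dE // dhomogX.
  by apply/eqP.
have b0 (j : 'I_r) : (k < j)%N -> b 0 j = 0.
  by move=> lt_kj; rewrite mxE w0 // raddf0 if_same.
have [t' admt' colE] := colon_list admt lt_l; clearbody b.
have -> : Mt l.+1 = [set w | exists u p, Mt l u /\ w = u + p *: b].
  apply/seteqP; split=> x /=.
    rewrite /Mt /= (take_nth 0%MM lt_l) => -[Nx x0 /mideal_rcons[q [a [tq xk]]]].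
    exists (x - a *: b), a; split; last by rewrite subrK.
    split=> [|j lt_kj|]; first by rewrite addrC -scaleNr; apply: NL.
      by rewrite !mxE x0 // b0 // mulr0 subr0.
    by rewrite !mxE bk xk addrK.
  move=> [u [p [[Nu u0 uk] ->]]]; split=> [|j lt_kj|].
  - by rewrite addrC; apply: NL.
  - by rewrite !mxE u0 // b0 // mulr0 addr0.
  - rewrite !mxE bk (take_nth 0%MM lt_l); apply: midealD => m0.
      move=> /uk[m1 m1t le_m1]; exists m1 => //.
      by rewrite /= mem_rcons inE m1t orbT.
    apply: midealM; apply/midealX; exists m; last exact: lepm_refl.
    by rewrite /= mem_rcons inE eqxx.
apply: (good_gensS (j := (mdeg m + sh k')%N) (t := t')) => //.
- by apply/IHl/ltnW.
- by move=> lin_; rewrite shc // (admt lin_).2 // addnC.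
rewrite -colE; apply/seteqP; split=> p /=.
  by move=> [_ _]; rewrite mxE bk.
move=> tp; split=> [|j lt_kj|]; last by rewrite mxE bk.
  by rewrite -[p *: b]addr0; apply: NL.
by rewrite mxE b0 ?mulr0.
Qed.

End Generators.

End Syzygies.

Section Resolutions.

Variables (n : nat) (K : fieldType).
Local Notation R := {mpoly K[n]}.

Lemma mideal_pihomog (S : set 'X_{1..n}) (j : nat) (p : R) :
  mideal S p -> mideal S (pihomog mdeg j p).
Proof.
move=> Sp; rewrite pihomogE -big_filter; apply: mideal_sum => m.
rewrite mem_filter => /andP[_ /Sp Sm].
by rewrite -mul_mpolyC; apply/midealM/midealX.
Qed.

(** A state of the construction of a resolution: a free module [R^srk] with shifts
    [ssh], the submodule [sN] still to be resolved and, in the linear case, the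
    degree [se] of the generators of its leading ideals and the common value [sc]
    of the shifts. *)
Record stage := Stage {
  srk : nat; ssh : 'I_srk -> nat; sN : set 'rV[R]_srk; se : nat; sc : nat }.

Definition good_stage (lin : bool) (x : stage) :=
  [/\ submod (sN (s := x)), graded (@ssh x) (sN (s := x)),
      mono_lead lin (se x) (sN (s := x)) & lin -> forall b, @ssh x b = sc x].

Definition next_stage (x y : stage) (B : 'M[R]_(srk y, srk x)) :=
  [/\ forall a, ghomog (@ssh x) (@ssh y a) (row a B),
      forall w, @sN x w <-> exists v, w = v *m B,
      @sN y = syz B & sc y = (sc x + se x)%N /\ se y = 1%N].

Lemma next_stage_exists lin x : good_stage lin x ->
  exists y, good_stage lin y /\ exists B, @next_stage x y B.
Proof.
move=> [subN gN leadN shc].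
have [s [B [sh' [hB NB leadB shE]]]] := mono_lead_gens subN gN leadN shc.
exists (@Stage s sh' (syz B) 1 (sc x + se x)); split.
  by split=> //=; [exact: submod_syz|exact: graded_syz hB].
by exists B.
Qed.

(** The states are iterated from the ideal as a submodule of [R]. In the linear case
    the generation degree is [D] at the start and [1] from then on, so the shifts
    are [D], [D + 1], [D + 2], and so on. *)
Theorem mideal_resolution lin D (t : seq 'X_{1..n}) : admissible lin D t ->
  exists F : gfree n K, is_resolution (mideal [set` t]) F /\
    (lin -> forall i (b : 'I_(grank F i)), gshift b = (D + i)%N).
Proof.
move=> admt; pose I : set R := mideal [set` t].
pose x0 := @Stage 1 (fun=> 0%N) [set w | I (w 0 0)] D 0.
have good0 : good_stage lin x0.
  split=> //=.
  - split=> [|a u v Iu Iv] /=; first by rewrite mxE; apply: mideal0.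
    by rewrite !mxE; apply: midealD Iv; apply: midealM.
  - by move=> j u Iu; rewrite /= mxE /=; apply: mideal_pihomog.
  - move=> k; exists t => //; rewrite ord1; apply/seteqP; split=> p /=.
      by move=> [w [Iw _ <-]].
    move=> Ip; exists p%:M; split; rewrite ?mxE //.
    by move=> j; rewrite ord1.
pose T := {x | good_stage lin x}.
have nextT (x : T) : exists yB : {y : T & 'M[R]_(srk (sval y), srk (sval x))},
    next_stage (projT2 yB).
  have [y [gy [B nB]]] := next_stage_exists (svalP x).
  by exists (existT _ (exist _ y gy) B).
pose f x := sval (cid (nextT x)).
have fP x : next_stage (projT2 (f x)) := svalP (cid (nextT x)).
clearbody f.
pose st := fix st i : T := if i is i'.+1 then projT1 (f (st i')) else exist _ x0 good0.
pose F := @GFree n K (fun i => srk (sval (st i.+1))) (fun i => @ssh (sval (st i.+1)))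
  (fun i => projT2 (f (st i.+1))) (projT2 (f (st 0%N))).
exists F; split.
  split.
  - move=> i a b; have [hB _ _ _] := fP (st i.+1).
    by have := hB a b; rewrite mxE.
  - move=> b; have [hB _ _ _] := fP (st 0%N).
    by have := hB b 0; rewrite mxE subn0.
  - move=> p; have [_ NB _ _] := fP (st 0%N).
    have -> : mideal [set` t] p <-> @sN x0 p%:M by rewrite /= mxE.
    by split=> [/NB[v ->]|[v E]]; [exists v|apply/NB; exists v].
  - move=> v; have [_ _ NE _] := fP (st 0%N); have [_ NB _ _] := fP (st 1%N).
    by rewrite -NB; change (st 1%N) with (projT1 (f (st 0%N))); rewrite NE.
  - move=> i v; have [_ _ NE _] := fP (st i.+1); have [_ NB _ _] := fP (st i.+2).
    by rewrite -NB; change (st i.+2) with (projT1 (f (st i.+1))); rewrite NE.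
move=> lin_ i b; transitivity (sc (sval (st i.+1))).
  by have [_ _ _ shE] := svalP (st i.+1); apply: shE.
suff [] : sc (sval (st i.+1)) = (D + i)%N /\ se (sval (st i.+1)) = 1%N by [].
elim: {b} i => [|i [IHc IHe]]; first by have [_ _ _] := fP (st 0%N); rewrite addn0.
by have [_ _ _] := fP (st i.+1); rewrite IHc IHe addn1 addnS.
Qed.

End Resolutions.

(** * Betti numbers from an arbitrary resolution *)

Section BettiNumbers.

Variables (n : nat) (K : fieldType).
Local Notation R := {mpoly K[n]}.
Implicit Types (I : set R) (F A : gfree n K).

Definition const_part r s (M : 'M[R]_(r, s)) : 'M[K]_(r, s) := map_mx (mcoeff 0%MM) M.

Lemma kcomp_rowP F i j (c : 'rV[K]_(grank F i)) :
  (c <= kcomp F i j)%MS <-> c *m kcomp F i j = c.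
Proof.
split=> [/submxP[x ->]|<-]; last exact: submxMl.
rewrite -mulmxA; congr (_ *m _); rewrite /kcomp mulmx_diag.
by congr diag_mx; apply/rowP => b; rewrite !mxE; case: eqP; rewrite ?mulr1 ?mulr0.
Qed.

Lemma kcomp_entry F i j (c : 'rV[K]_(grank F i)) b :
  (c <= kcomp F i j)%MS -> gshift b != j -> c 0 b = 0.
Proof.
move=> /kcomp_rowP <- /negPf nb.
by rewrite /kcomp mul_mx_diag !mxE nb mulr0.
Qed.

Lemma resolution_homog I F : is_resolution I F ->
  forall i a, ghomog (@gshift _ _ F i) (gshift a) (row a (gdiff F i)).
Proof. by move=> [hF _ _ _ _] i a b; rewrite !mxE; apply: hF. Qed.

Lemma kdiff_entry I F i a b : is_resolution I F ->
  gshift a != gshift b -> kdiff F i a b = 0.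
Proof.
move=> [hF _ _ _ _] ne; rewrite /kdiff mxE; have := hF i a b.
case: leqP => [le_ba hab|_ /eqP ->]; last by rewrite mcoeff0.
by rewrite (dhomog_nemf_coeff hab) //= mdeg0; lia.
Qed.

Lemma kboundariesE I F i j : is_resolution I F ->
  kboundaries F i j = kdiff F i *m kcomp F i j.
Proof.
move=> resF; apply/matrixP => a b.
rewrite /kboundaries /kcomp mul_diag_mx mul_mx_diag !mxE.
have [->|ne] := eqVneq (gshift a) (gshift b); first by rewrite mulrC.
by have := kdiff_entry resF ne; rewrite /kdiff mxE => ->; rewrite mulr0 mul0r.
Qed.

Section Comparison.

Variables (I : set R) (F A : gfree n K) (D : nat).
Hypotheses (resF : is_resolution I F) (resA : is_resolution I A).
Hypothesis linA : forall i (b : 'I_(grank A i)), gshift b = (D + i)%N.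

Definition cycle (G : gfree n K) i : set 'rV[R]_(grank G i) :=
  match i with
  | 0 => fun v => v *m gaug G = 0
  | i'.+1 => fun v => v *m gdiff G i' = 0
  end.

(** Elements that become cycles modulo the variables. *)
Definition kcycle (G : gfree n K) i : set 'rV[R]_(grank G i) :=
  match i with
  | 0 => fun=> True
  | i'.+1 => fun v => const_part (v *m gdiff G i') = 0
  end.

Lemma cycleP J G i (v : 'rV[R]_(grank G i)) : is_resolution J G ->
  cycle v <-> exists u, v = u *m gdiff G i.
Proof. by move=> [_ _ _ ex0 ex]; case: i v => [|i] v; [apply: ex0|apply: ex]. Qed.

Lemma lift_rows r s q (M : 'M[R]_(r, q)) (B : 'M[R]_(s, q)) (P : 'I_r -> set 'rV[R]_s) :
  (forall a, exists2 v, P a v & row a M = v *m B) ->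
  exists2 X, X *m B = M & forall a, P a (row a X).
Proof.
move=> ex; have [f fP] := boolp.choice (fun a =>
  let: ex_intro2 v Pv E := ex a in ex_intro (fun v => P a v /\ row a M = v *m B) v (conj Pv E)).
exists (\matrix_a f a) => [|a]; last by rewrite rowK; have [] := fP a.
by apply/row_matrixP => a; rewrite row_mul rowK; have [_ ->] := fP a.
Qed.

Lemma lift_rows0 r s q (M : 'M[R]_(r, q)) (B : 'M[R]_(s, q)) :
  (forall a, exists v, row a M = v *m B) -> exists X, X *m B = M.
Proof.
move=> ex; have [|X XE _] := @lift_rows _ _ _ M B (fun=> setT); last by exists X.
by move=> a; have [v vE] := ex a; exists v.
Qed.

Lemma ghomog_mul r s (sh : 'I_r -> nat) (sh' : 'I_s -> nat) j (B : 'M[R]_(s, r)) v :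
  (forall a, ghomog sh (sh' a) (row a B)) -> ghomog sh' j v -> ghomog sh j (v *m B).
Proof.
move=> hB hv; suff <- : hcomp sh j (v *m B) = v *m B by apply: hcompP.
by rewrite (hcomp_mul _ _ hB) hcomp_id.
Qed.

Lemma lift_homog r s (sh : 'I_r -> nat) (sh' : 'I_s -> nat) j (B : 'M[R]_(s, r)) u v :
  (forall a, ghomog sh (sh' a) (row a B)) -> ghomog sh j u -> u = v *m B ->
  exists2 w, ghomog sh' j w & u = w *m B.
Proof.
move=> hB hu uE; exists (hcomp sh' j v); first exact: hcompP.
by rewrite -[LHS](hcomp_id hu) uE (hcomp_mul _ _ hB).
Qed.

(** The comparison maps [phi] and [psi] of two resolutions, with the homotopy [h]
    from [psi] after [phi] to the identity. The term of the homotopy formula that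
    starts with the differential of [v] vanishes on cycles, and modulo the variables
    on [kcycle]s; in this form the formula mentions no map of lower index, and the
    induction carries a single degree. *)
Lemma comparison i : exists (phi : 'M[R]_(grank F i, grank A i))
    (psi : 'M[R]_(grank A i, grank F i)) (h : 'M[R]_(grank F i, grank F i.+1)),
  [/\ (forall v, cycle v -> cycle (v *m phi)) /\
      (forall v, cycle v -> cycle (v *m psi)),
      forall v, cycle v -> v *m phi *m psi - v = v *m h *m gdiff F i,
      forall v, kcycle v ->
        const_part (v *m phi *m psi - v) = const_part (v *m h *m gdiff F i)
    & forall a, ghomog (@gshift _ _ A i) (gshift a) (row a phi)].
Proof.
have cycF i0 (v : 'rV[R]_(grank F i0)) : cycle v <-> exists u, v = u *m gdiff F i0.
  exact: cycleP resF.
have cycA i0 (v : 'rV[R]_(grank A i0)) : cycle v <-> exists u, v = u *m gdiff A i0.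
  exact: cycleP resA.
elim: i => [|i [phi [psi [h [[phiZ psiZ] hZ _ hphi]]]]].
  have [_ augF IF _ _] := resF; have [_ augA IA _ _] := resA.
  have gaugI G a : is_resolution I G -> I (gaug G a 0).
    move=> [_ _ IG _ _]; apply/IG; exists (delta_mx 0 a).
    by rewrite -rowE [row a _]mx11_scalar mxE.
  have [phi phiE hphi] : exists2 phi, phi *m gaug A = gaug F &
      forall a, ghomog (@gshift _ _ A 0) (gshift a) (row a phi).
    apply: (lift_rows (P := fun a =>
      ghomog (@gshift _ _ A 0) (@gshift _ _ F 0 a))) => a.
    have /IA[v vE] := gaugI _ a resF.
    apply: (@lift_homog _ _ (fun=> 0%N) _ _ _ _ v).
    - by move=> b c; rewrite mxE subn0 ord1 augA.
    - by move=> c; rewrite mxE subn0 ord1 augF.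
    - by rewrite vE [LHS]mx11_scalar mxE.
  have [psi psiE] : exists psi, psi *m gaug F = gaug A.
    apply: lift_rows0 => a.
    have /IF[v vE] := gaugI _ a resA.
    by exists v; rewrite vE [LHS]mx11_scalar mxE.
  have [h hE] : exists h, h *m gdiff F 0 = phi *m psi - 1%:M.
    apply: lift_rows0 => a.
    have /cycF[u uE] : cycle (row a (phi *m psi - 1%:M)).
      by rewrite /cycle -row_mul mulmxBl mul1mx -mulmxA psiE phiE subrr row0.
    by exists u.
  exists phi, psi, h; split=> //; first split=> v /=.
  - by rewrite -mulmxA phiE.
  - by rewrite -mulmxA psiE.
  - by move=> v _; rewrite -!mulmxA hE mulmxBr mulmx1 mulmxA.
  - by move=> v _; rewrite -!mulmxA hE mulmxBr mulmx1 mulmxA.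
have [phi' phiE hphi'] : exists2 phi', phi' *m gdiff A i = gdiff F i *m phi &
    forall a, ghomog (@gshift _ _ A i.+1) (gshift a) (row a phi').
  apply: (lift_rows (P := fun a =>
    ghomog (@gshift _ _ A i.+1) (@gshift _ _ F i.+1 a))) => a.
  have /cycA[v vE] : cycle (row a (gdiff F i *m phi)).
    rewrite row_mul; apply: phiZ; apply/cycF; exists (delta_mx 0 a).
    by rewrite -rowE.
  apply: lift_homog vE; first exact: resolution_homog resA i.
  by rewrite row_mul; apply: ghomog_mul hphi _; apply: resolution_homog resF i a.
have [psi' psiE] : exists psi', psi' *m gdiff F i = gdiff A i *m psi.
  apply: lift_rows0 => a.
  have /cycF[v vE] : cycle (row a (gdiff A i *m psi)).
    rewrite row_mul; apply: psiZ; apply/cycA; exists (delta_mx 0 a).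
    by rewrite -rowE.
  by exists v.
have dh : gdiff F i *m phi *m psi - gdiff F i = gdiff F i *m h *m gdiff F i.
  apply/row_matrixP => a; rewrite raddfB /= !row_mul; apply: hZ.
  by apply/cycF; exists (delta_mx 0 a); rewrite -rowE.
have [h' hE] : exists h', h' *m gdiff F i.+1 = phi' *m psi' - 1%:M - gdiff F i *m h.
  apply: lift_rows0 => a.
  have /cycF[u uE] : cycle (row a (phi' *m psi' - 1%:M - gdiff F i *m h)).
    rewrite /cycle -row_mul !mulmxBl mul1mx -!mulmxA psiE !mulmxA phiE -dh.
    by rewrite subrr row0.
  by exists u.
have hE' v : v *m phi' *m psi' - v = v *m gdiff F i *m h + v *m h' *m gdiff F i.+1.
  by rewrite -!mulmxA hE !mulmxBr mulmx1 [RHS]addrC subrK.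
exists phi', psi', h'; split=> //; first split=> v /=.
- by move=> v0; rewrite -mulmxA phiE mulmxA v0 mul0mx.
- by move=> v0; rewrite -mulmxA psiE mulmxA v0 mul0mx.
- by move=> v /= v0; rewrite hE' v0 mul0mx add0r.
- move=> v /= v0; rewrite hE' {1}/const_part map_mxD.
  rewrite (map_mxM _ (v *m gdiff F i)) -[map_mx _ (v *m _)]/(const_part _) v0.
  by rewrite mul0mx add0r.
Qed.

Lemma const_partC r s (M : 'M[K]_(r, s)) : const_part (map_mx (@mpolyC n K) M) = M.
Proof. by apply/matrixP => x y; rewrite !mxE mpolyCK. Qed.

Lemma kcycles_sub i j (c : 'rV[K]_(grank F i)) : (c <= kcycles F i j)%MS ->
  (c <= kcomp F i j)%MS /\ kcycle (map_mx (@mpolyC n K) c).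
Proof.
case: i c => [|i] c //=; rewrite sub_capmx => /andP[ccomp /sub_kermxP c0].
by split=> //; rewrite /const_part map_mxM -/(const_part _) const_partC.
Qed.

(** A class of degree [j > D + i] is constant on generators of shift [j], and [phi]
    maps these to elements of positive degree over the generators of shift [D + i].
    So [phi] is zero on it modulo the variables, and the homotopy makes the class a
    boundary. *)
Lemma hdim_linear i j : (D + i < j)%N -> hdim F i j = 0%N.
Proof.
move=> lt_j; apply/eqP; rewrite subn_eq0; apply: mxrankS; apply/rV_subP => c.
move=> /kcycles_sub[ccomp cz].
have [phi [psi [h [_ _ hZ hphi]]]] := comparison i.
have := hZ _ cz.
rewrite /const_part map_mxB !map_mxM.
rewrite -[map_mx _ (map_mx _ c)]/(const_part _) const_partC.
set y := c *m map_mx _ h.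
have -> : c *m map_mx (mcoeff 0%MM) phi = 0.
  apply/rowP => b; rewrite !mxE big1 // => b' _.
  have [b'j|nb'] := eqVneq (gshift b') j; last by rewrite (kcomp_entry ccomp nb') mul0r.
  have := hphi b' b; rewrite linA b'j ltnW // !mxE => hb.
  by rewrite (dhomog_nemf_coeff hb) ?mulr0 //= mdeg0; lia.
rewrite mul0mx sub0r => /(canRL (@opprK _)) cE.
have /kcomp_rowP cK := ccomp.
suff -> : c = - y *m kboundaries F i j by apply: submxMl.
by rewrite -{1}cK {1}cE (kboundariesE _ _ resF) mulmxA !mulNmx.
Qed.

End Comparison.

End BettiNumbers.

Section NonzeroBettiNumbers.

Variables (n : nat) (K : fieldType).
Local Notation R := {mpoly K[n]}.
Variables (I : set R) (F : gfree n K).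
Hypothesis resF : is_resolution I F.

Lemma mcoeffM_eq0 (p q : R) m :
  (forall m1 m2, m = (m1 + m2)%MM -> p@_m1 * q@_m2 = 0) -> (p * q)@_m = 0.
Proof. by move=> pq0; rewrite mcoeffM big1 // => k /eqP/pq0. Qed.

Lemma gaug_ideal b : I (gaug F b 0).
Proof.
have [_ _ IF _ _] := resF; apply/IF; exists (delta_mx 0 b).
by rewrite -rowE [row b _]mx11_scalar mxE.
Qed.

Lemma gdiff_comp i : gdiff F i.+1 *m gdiff F i = 0.
Proof.
have [_ _ _ _ ex] := resF; apply/row_matrixP => a; rewrite row_mul row0.
by apply/ex; exists (delta_mx 0 a); rewrite -rowE.
Qed.

Lemma kboundaries_kcycles i j : (kboundaries F i j <= kcycles F i j)%MS.
Proof.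
have le_comp : (kboundaries F i j <= kcomp F i j)%MS.
  by rewrite (kboundariesE _ _ resF) submxMl.
case: i le_comp => [|i] //= le_comp; rewrite sub_capmx le_comp /=.
apply/sub_kermxP; rewrite /kboundaries -mulmxA /kdiff -map_mxM gdiff_comp.
by rewrite map_mx0 mulmx0.
Qed.

Lemma hdim_eq0 i j : hdim F i j = 0%N -> (kcycles F i j <= kboundaries F i j)%MS.
Proof.
move=> /eqP; rewrite subn_eq0 => le_rk.
by rewrite -(geq_leqif (mxrank_leqif_sup (kboundaries_kcycles i j))).
Qed.

(** If [hdim F 0 D] were zero, the constant coefficients of [f] on the generators of
    shift [D] could be cancelled by relations. As the ideal has no element of degree
    less than [D], the combination that remains has no term of degree [D]. *)
Lemma hdim0_neq0 D (f : R) : (forall p m, I p -> m \in msupp p -> (D <= mdeg m)%N) ->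
  I f -> f \is D.-homog -> f != 0 -> hdim F 0 D <> 0%N.
Proof.
move=> geD If hf nz_f /hdim_eq0 cyc.
have [_ haug IF _ _] := resF; have [v vE] := (IF f).1 If.
have : (const_part v *m kcomp F 0 D <= kboundaries F 0 D)%MS.
  by apply: submx_trans cyc; apply: submxMl.
rewrite (kboundariesE _ _ resF) => /submxP[y]; rewrite mulmxA => cE.
pose s := v - map_mx (@mpolyC n K) y *m gdiff F 0.
have sE : s *m gaug F = f%:M.
  have [_ _ _ ex _] := resF.
  rewrite mulmxBl -vE (ex (_ *m _)).2 ?subr0 //.
  by exists (map_mx (@mpolyC n K) y).
have s0 b : gshift b = D -> (s 0 b)@_0 = 0.
  move=> bD; have : const_part s *m kcomp F 0 D = 0.
    rewrite /const_part map_mxB map_mxM -!/(const_part _) const_partC.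
    by rewrite mulmxBl cE subrr.
  by move=> /rowP/(_ b); rewrite /kcomp mul_mx_diag !mxE bD eqxx mulr1.
have : f@_(mlead f) = 0; last by move/eqP; rewrite mleadc_eq0 (negPf nz_f).
have hm : mdeg (mlead f) = D by apply: (dhomog_mf hf); apply: mlead_supp.
move: (mlead f) hm => m hm.
have -> : f = \sum_b s 0 b * gaug F b 0.
  by have := congr1 (fun M : 'M_1 => M 0 0) sE; rewrite !mxE eqxx mulr1n => ->.
rewrite raddf_sum big1 //= => b _; apply: mcoeffM_eq0 => m1 m2 /(congr1 mdeg).
rewrite mdegD hm => degE; have [m10|nz_m1] := eqVneq m1 0%MM.
  have [bD|nbD] := eqVneq (gshift b) D; first by rewrite m10 s0 // mul0r.
  rewrite (dhomog_nemf_coeff (haug b)) ?mulr0 //=.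
  by move: degE; rewrite m10 mdeg0 add0n => <-; rewrite eq_sym.
rewrite [X in _ * X]memN_msupp_eq0 ?mulr0 //; apply/negP => /(geD _ _ (gaug_ideal b)).
by move: nz_m1; rewrite -mdeg_eq0; lia.
Qed.


Definition div_part (i : 'I_n) (p : R) : R :=
  \sum_(m <- msupp p | m i != 0%N) p@_m *: 'X_[m].

Lemma mcoeff_div_part i p m : (div_part i p)@_m = if m i != 0%N then p@_m else 0.
Proof.
rewrite /div_part raddf_sum /= [p in RHS](mpolyE p) [in RHS]raddf_sum /= big_mkcond.
rewrite (eq_bigr (fun k => (m i != 0%N)%:R * (p@_k *: 'X_[k])@_m)).
  by rewrite -mulr_sumr; case: ifP; rewrite ?mul1r ?mul0r.
move=> k _; rewrite mcoeffZ mcoeffX; case: (k =P m) => [->|_].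
  by case: ifP; rewrite ?mul1r ?mul0r.
by rewrite !mulr0 if_same.
Qed.

Lemma div_partP i : linear (div_part i).
Proof.
move=> a p q; apply/mpolyP => m; rewrite mcoeffD mcoeffZ !mcoeff_div_part.
by rewrite mcoeffD mcoeffZ; case: ifP; rewrite ?mulr0 ?addr0.
Qed.

HB.instance Definition _ i := GRing.isLinear.Build K R R _ (div_part i) (div_partP i).

Lemma div_part_id i p (m : 'X_{1..n}) : m i != 0%N -> div_part i ('X_[m] * p) = 'X_[m] * p.
Proof.
move=> mi; apply/mpolyP => m'; rewrite mcoeff_div_part mulrC.
case: ifP => // /negbFE/eqP m'i; apply/esym/mcoeffM_eq0 => m1 m2 m'E.
rewrite mcoeffX; case: eqP => [mE|_]; last by rewrite mulr0.
by move: mi; rewrite mE -lt0n; move: m'i; rewrite m'E mnmDE; lia.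
Qed.

(** The linear form [lam] on the free module [F_0] keeps in each coordinate the
    terms divisible by ['X_i0] and then takes the coefficient of ['X_[al]] in the
    image. By the hypothesis on the cofactors of the ideal in ['X_[al]], a multiple of
    a variable is kept as a whole or ignored as a whole, hence [lam] vanishes on the
    combinations of syzygies with coefficients in the maximal ideal. It does not
    vanish on the syzygy between [f] and [g], as only the cofactor of [f] is
    divisible by ['X_i0]. *)
Lemma hdim1_neq0 (S : set 'X_{1..n}) (al f g : 'X_{1..n}) (i0 : 'I_n) :
  I = mideal S -> S f -> S g -> (f <= al)%MM -> (g <= al)%MM ->
  (forall m b i, S m -> (m + b <= al)%MM -> b i0 != 0%N -> i != i0 -> b i = 0%N) ->
  (al - f)%MM i0 != 0%N -> (al - g)%MM i0 = 0%N -> g != al ->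
  hdim F 1 (mdeg al) <> 0%N.
Proof.
move=> IE Sf Sg le_f le_g sep fi0 gi0 ne_g /hdim_eq0 cyc.
have [hF haug IF ex0 ex] := resF.
pose lam (v : 'rV[R]_(grank F 0)) := \sum_b (div_part i0 (v 0 b) * gaug F b 0)@_al.
have lamE v w : lam (v + w) = lam v + lam w.
  rewrite -big_split; apply: eq_bigr => b _ /=.
  by rewrite mxE raddfD mulrDl mcoeffD.
have lamZ a v : lam (a%:MP *: v) = a * lam v.
  rewrite mulr_sumr; apply: eq_bigr => b _ /=.
  by rewrite mxE mul_mpolyC linearZ /= -scalerAl mcoeffZ.
have lamN v : lam (- v) = - lam v.
  by rewrite -scaleN1r -mpolyC1 -mpolyCN lamZ mulN1r.
have lam_in (m : 'X_{1..n}) v : m i0 != 0%N ->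
    lam ('X_[m] *: v) = ('X_[m] * (v *m gaug F) 0 0)@_al.
  move=> mi0; rewrite mxE mulr_sumr raddf_sum; apply: eq_bigr => b _ /=.
  by rewrite mxE div_part_id // mulrA.
have lam_out (m : 'X_{1..n}) v : m i0 = 0%N -> m != 0%MM -> lam ('X_[m] *: v) = 0.
  move=> mi0 nz_m; have [i mi] : exists i, m i != 0%N.
    apply/existsP; apply: contra_neqT nz_m; rewrite negb_exists => /forallP m0.
    by apply/mnmP => i; rewrite mnm0E; apply/eqP/negPn.
  apply: big1 => b _; apply: mcoeffM_eq0 => m1 m2 alE.
  rewrite mxE mcoeff_div_part; case: ifP => m1i0; last by rewrite mul0r.
  have [m2b|/memN_msupp_eq0 ->] := boolP (m2 \in msupp (gaug F b 0)); last by rewrite mulr0.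
  have := gaug_ideal b; rewrite IE => /(_ _ m2b)[m' Sm' le_m'].
  have le_al : (m' + m1 <= al)%MM.
    by apply/mnm_lepP => j; move/mnm_lepP/(_ j): le_m'; rewrite alE !mnmDE; lia.
  have ne_i : i != i0 by apply: contraNneq mi => ->; rewrite mi0.
  have m1i := sep _ _ _ Sm' le_al m1i0 ne_i.
  rewrite mulrC (mcoeffM_eq0 (m := m1)) ?mul0r ?mulr0 // => a1 a2 m1E.
  rewrite mcoeffX; case: eqP => [mE|_]; last by rewrite mul0r.
  by move: mi m1i; rewrite mE m1E mnmDE -lt0n; lia.
have lam_sum (J : Type) (r : seq J) (G : J -> 'rV[R]_(grank F 0)) :
    lam (\sum_(j <- r) G j) = \sum_(j <- r) lam (G j).
  elim/big_rec2: _ => [|j y1 y2 _ <-]; last by rewrite lamE.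
  by apply: big1 => b _; rewrite mxE raddf0 mul0r mcoeff0.
(* Both factors of a coordinate of the image are homogeneous, of total degree the
   shift of a. *)
have lam_row (a : 'I_(grank F 1)) : gshift a != mdeg al -> lam (row a (gdiff F 0)) = 0.
  move=> ne_a; apply: big1 => b _; apply: mcoeffM_eq0 => m1 m2 /(congr1 mdeg).
  rewrite mdegD mcoeff_div_part mxE => degE; case: ifP => _; last by rewrite mul0r.
  have := hF 0%N a b; case: leqP => [le_ba hab|_ /eqP ->]; last by rewrite mcoeff0 mul0r.
  have [e1|n1] := eqVneq (mdeg m1) (gshift a - gshift b)%N; last first.
    by rewrite (dhomog_nemf_coeff hab) ?mul0r.
  rewrite [X in _ * X](dhomog_nemf_coeff (haug b)) ?mulr0 //=.
  by apply: contra_neq ne_a => e2; rewrite degE e1 e2 subnK.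
have lam0 (u : 'rV[R]_(grank F 1)) :
    (forall a, gshift a = mdeg al -> (u 0 a)@_0 = 0) -> lam (u *m gdiff F 0) = 0.
  move=> u0; rewrite mulmx_sum_row lam_sum big1 // => a _.
  rewrite {1}(mpolyE (u 0 a)) scaler_suml lam_sum big1 // => m _.
  rewrite -mul_mpolyC -scalerA lamZ.
  have [->|nz_m] := eqVneq m 0%MM.
    rewrite mpolyX0 scale1r; have [/u0 ->|/lam_row ->] := eqVneq (gshift a) (mdeg al).
      by rewrite mul0r.
    by rewrite mulr0.
  have [mi0|mi0] := eqVneq (m i0) 0%N; first by rewrite lam_out ?mulr0.
  rewrite lam_in // (ex0 _).2 ?mxE ?mulr0 ?mcoeff0 ?mulr0 //.
  by exists (delta_mx 0 a); rewrite -rowE.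
have [p pE] : exists p, p *m gaug F = 'X_[f]%:M.
  have /IF[v vE] : I 'X_[f] by rewrite IE; apply/midealX; exists f => //; apply: lepm_refl.
  by exists v.
have [q qE] : exists q, q *m gaug F = 'X_[g]%:M.
  have /IF[v vE] : I 'X_[g] by rewrite IE; apply/midealX; exists g => //; apply: lepm_refl.
  by exists v.
pose sg := 'X_[(al - f)%MM] *: p - 'X_[(al - g)%MM] *: q.
have nz_g : (al - g)%MM != 0%MM.
  by apply: contra_neq ne_g => ag0; rewrite -[RHS](submK le_g) ag0 add0m.
have lam_sg : lam sg = 1.
  rewrite /sg lamE lamN (lam_out (al - g)%MM) // oppr0 addr0 lam_in // pE.
  rewrite mxE eqxx mulr1n -mpolyXD submK //.
  by rewrite mcoeffX eqxx.
have /ex0[w wE] : sg *m gaug F = 0.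
  rewrite mulmxBl -!scalemxAl pE qE !scale_scalar_mx -!mpolyXD !submK //.
  by rewrite subrr.
have const_sg : const_part sg = 0.
  apply/rowP => b; rewrite !mxE mcoeffB.
  have X0 m (r : R) : m != 0%MM -> ('X_[m] * r)@_0 = 0.
    move=> nz_m; apply: mcoeffM_eq0 => m1 m2 /esym/eqP; rewrite mnmD_eq0.
    by move=> /andP[/eqP -> _]; rewrite mcoeffX (negPf nz_m) mul0r.
  rewrite !X0 ?subrr //; apply: contraNneq fi0 => ->; by rewrite mnm0E.
(* Hence the constant part of w in degree mdeg al is a cycle modulo the variables. *)
have wcyc : (const_part w *m kcomp F 1 (mdeg al) <= kcycles F 1 (mdeg al))%MS.
  rewrite /= sub_capmx submxMl /=; apply/sub_kermxP.
  rewrite -mulmxA -[_ *m kdiff F 0]/(kboundaries F 0 _) (kboundariesE _ _ resF).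
  by rewrite mulmxA /kdiff -map_mxM -wE -/(const_part _) const_sg mul0mx.
have := submx_trans wcyc cyc.
rewrite (kboundariesE _ _ resF) => /submxP[y]; rewrite mulmxA => cE.
(* The same syzygy without constant coefficients in that degree. *)
pose u := w - map_mx (@mpolyC n K) y *m gdiff F 1.
have uE : u *m gdiff F 0 = sg by rewrite mulmxBl -wE -mulmxA gdiff_comp mulmx0 subr0.
have : lam sg = 0.
  rewrite -uE; apply: lam0 => a aE; have : const_part u *m kcomp F 1 (mdeg al) = 0.
    rewrite /const_part map_mxB map_mxM -!/(const_part _) const_partC.
    by rewrite mulmxBl cE subrr.
  by move=> /rowP/(_ a); rewrite /kcomp mul_mx_diag !mxE aE eqxx mulr1.
by rewrite lam_sg => /eqP; rewrite oner_eq0.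
Qed.

End NonzeroBettiNumbers.

(** * Regularity *)

Section Regularity.

(** A nonempty bounded set of integers has a maximum, so every set of extended
    integers has a least upper bound. *)
Lemma ereal_int_supremum (A : set (\bar int)) : supremums A (supremum (-oo)%E A).
Proof.
have supNy : A `<=` [set -oo%E] -> supremums A (-oo)%E.
  by move=> AN; split=> [x /AN ->//|y _]; apply: leNye.
suff ex : supremums A !=set0.
  rewrite /supremum; case: ifP => [/eqP A0|_]; last exact: xgetPex.
  by apply: supNy; rewrite A0.
have [[z zub]|nz] := pselect (exists z : int, ubound A z%:E); last first.
  exists (+oo)%E; split=> [x _|[y| |] yub]; [exact: leey| |by []|].
    by case: nz; exists y.
  case: nz; exists 0 => x /yub; case: x => // _; exact: leNye.
have [[x Ax]|nx] := pselect (exists x : int, A x%:E); last first.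
  exists (-oo)%E; apply: supNy => -[y| |] Ay //=; first by case: nx; exists y.
  by have := zub _ Ay.
pose P k := `[< ubound A (z - k%:Z)%:E >].
have P0 : exists k, P k by exists 0%N; apply/asboolP; rewrite subr0.
have Ple k : P k -> (k <= `|z - x|)%N.
  by move=> /asboolP/(_ _ Ax); rewrite lee_fin; lia.
have [k /asboolP kub kmax] := ex_maxnP P0 Ple.
exists (z - k%:Z)%:E; split=> // -[y| |] yub; [|exact: leey|].
  rewrite lee_fin leNgt; apply/negP => lty.
  suff /kmax : P k.+1 by rewrite ltnn.
  apply/asboolP => w /yub le_w; apply: le_trans le_w _; rewrite lee_fin; lia.
by have := yub _ Ax.
Qed.

Variables (n : nat) (K : fieldType).
Implicit Types (I : set {mpoly K[n]}).

Lemma reg_ge I i j : betti I i j <> 0%N -> ((j%:Z - i%:Z)%:E <= reg I)%E.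
Proof.
move=> /eqP nz.
have [ub _] := ereal_int_supremum [set (tmax I i - (i%:Z)%:E)%E | i in [set: nat]].
have [ubt _] := ereal_int_supremum [set (j%:Z)%:E | j in [set j : nat | betti I i j != 0%N]].
have le_t : ((j%:Z)%:E <= tmax I i)%E by apply: ubt; exists j.
apply: (@le_trans _ _ (tmax I i - (i%:Z)%:E)%E); last by apply: ub; exists i.
case: (tmax I i) le_t => [t| _|//]; last exact: leey.
by rewrite -EFinB !lee_fin; lia.
Qed.

Lemma reg_linear I D : betti I 0 D <> 0%N ->
  (forall i j, betti I i j <> 0%N -> (j <= D + i)%N) -> reg I = (D%:Z)%:E.
Proof.
move=> nz lin; apply/eqP; rewrite eq_le; apply/andP; split; last first.
  by have := reg_ge nz; rewrite subr0.
have [_ lb] := ereal_int_supremum [set (tmax I i - (i%:Z)%:E)%E | i in [set: nat]].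
apply: lb => _ [i _ <-].
have [_ lbt] := ereal_int_supremum [set (j%:Z)%:E | j in [set j : nat | betti I i j != 0%N]].
have : (tmax I i <= (D + i)%N%:Z%:E)%E.
  by apply: lbt => _ [j /eqP/lin le_j <-]; rewrite lee_fin; lia.
case: (tmax I i) => [t|//|_]; last exact: leNye.
by rewrite -EFinB !lee_fin; lia.
Qed.

Lemma resolutionP I : (exists F, is_resolution I F) -> is_resolution I (resolution I).
Proof. exact: Stdlib.Logic.ClassicalEpsilon.epsilon_spec. Qed.

Lemma reg_lin_quot D (t : seq 'X_{1..n}) : lin_quot t ->
  (forall m, m \in t -> mdeg m = D) -> t != [::] ->
  reg (mideal (K := K) [set` t]) = (D%:Z)%:E.
Proof.
move=> lq tD nz_t.
have [A [resA linA]] : exists A : gfree n K, is_resolution (mideal [set` t]) A /\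
    (true -> forall i (b : 'I_(grank A i)), gshift b = (D + i)%N).
  by apply: mideal_resolution.
have resF := resolutionP (ex_intro _ A resA).
apply: reg_linear => [|i j nz].
  case: t nz_t tD {lq resA} resF => // m t _ tD resF.
  apply: (hdim0_neq0 (f := 'X_[m]) resF).
  - by move=> p m' /[apply] -[m0 /tD <-] le_m; rewrite -(submK le_m) mdegD leq_addl.
  - by apply/midealX; exists m; [apply: mem_head|apply: lepm_refl].
  - by rewrite dhomogX; apply/eqP/tD/mem_head.
  - by rewrite -msupp_eq0 msuppX.
rewrite leqNgt; apply/negP => lt_j; apply: nz.
exact: (hdim_linear resF resA (linA isT) lt_j).
Qed.

End Regularity.

Theorem theorem4p1 (d : nat) (d_gt1 : (1 < d)%N) (K : fieldType) :
  [/\ forall k : nat, (0 < k < d)%N -> linear_quotients (idealexp (idealJ K d) k),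
      betti (idealexp (idealJ K d) d) 1 (d * d.+1 + d) <> 0%N,
      forall k : nat, (0 < k < d)%N ->
        reg (idealexp (idealJ K d) k) = ((k * d.+1)%N%:Z)%:E &
      (((d * d.+1 + d)%N%:Z - 1)%:E <= reg (idealexp (idealJ K d) d))%E].
Proof.
have d_gt0 := ltnW d_gt1.
have JE k : (0 < k)%N -> idealexp (idealJ K d) k = mideal [set` Jlist d k].
  by move=> k_gt0; rewrite idealexpJE // mideal_Jlist.
have degJ k m : m \in Jlist d k -> mdeg m = (k * d.+1)%N.
  by rewrite mem_Jlist => /asboolP/mdeg_Jgen.
have bettiJ : betti (idealexp (idealJ K d) d) 1 (d * d.+1 + d) <> 0%N.
  have [gJ fJ] := Jgen_top d_gt1.
  pose al := mon4 d d (d * d.-1) d.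
  have alE : mdeg al = (d * d.+1 + d)%N.
    have le_dd : (d <= d * d)%N by rewrite leq_pmull; lia.
    have dd : (d * d.-1 = d * d - d)%N by rewrite -subn1 mulnBr muln1.
    by rewrite mdeg4 !mon4E dd mulnSr; lia.
  have resJ : is_resolution (idealexp (idealJ K d) d) (resolution (idealexp (idealJ K d) d)).
    apply: resolutionP; rewrite JE //.
    have [|F [resF _]] := @mideal_resolution 4 K false 0 (Jlist d d); first by [].
    by exists F.
  have JdE := idealexpJE K d_gt0 d_gt0.
  rewrite -alE; apply: (hdim1_neq0 resJ JdE fJ gJ (i0 := @Ordinal 4 0 isT)).
  - by apply: mnm4_le; rewrite !mon4E.
  - by apply: mnm4_le; rewrite !mon4E.
  - by move=> m b i; apply: Jgen_top_disconnected.
  - by rewrite mnmBE !mon4E; lia.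
  - by rewrite mnmBE !mon4E; lia.
  - by apply/eqP => /mnmP/(_ (@Ordinal 4 1 isT)); rewrite !mon4E; lia.
split=> [k ltk| |k ltk|] //; last exact: reg_ge bettiJ.
- have [k_gt0 _] := andP ltk; rewrite JE //.
  exact: lin_quot_linear_quotients (lin_quot_Jlist ltk) (@degJ k).
- have [k_gt0 _] := andP ltk; rewrite JE //.
  apply: reg_lin_quot (lin_quot_Jlist ltk) (@degJ k) _.
  have mJ : mon4 0 0 (k * d.+1) 0 \in Jlist d k.
    by rewrite mem_Jlist; apply/asboolP; split; rewrite !mon4E ?muln0; lia.
  by case: (Jlist d k) mJ.
Qed.
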